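(* (i) Let $v=(v_1,\dots,v_d)$ with $v_i\in\mathcal{L}((\mathbb{R}^d))$, and let $\mathbf{X}$ be an sgrp over $\mathbb{R}^d$ on $[0,T]$. The unique solution of $$\dot{\mathbf{Z}}_t=\mathbf{Z}_t\otimes(T_v\dot{\mathbf{X}}_{t,t}),\qquad\mathbf{Z}_0=T_v\mathbf{X}_0$$ takes values in $G(\mathbb{R}^d)$, is again an sgrp, and $\mathbf{Z}_t=T_v(\mathbf{X}_t)$, $\mathbf{Z}_{s,t}=T_v(\mathbf{X}_{s,t})$. If $\mathbf{X}$ is an sgrm, applying this to $t\mapsto\mathbf{X}_{0,t}$ yields an sgrm $\mathbf{Z}$ with $\mathbf{Z}_{s,t}=T_v(\mathbf{X}_{s,t})$. (ii) Let now $v_i\in\mathcal{L}(\mathbb{R}^d)$ for all $i$ and let $\mathbf{X}$ be a good sgrm. Then $\mathbf{Z}$ from (i) is a good sgrm. More specifically, let $N'$ be the smallest integer with $v_i\in\mathcal{L}^{N'}(\mathbb{R}^d)$ for all $i$, assume $\mathbf{X}=\mathrm{MinExt}(\mathbf{Y})$ for an $N$-sgrm $\mathbf{Y}$, and let $M=N\cdot N'$. Then the unique solution of $\dot{\mathbf{W}}_t=\mathbf{W}_t\otimes_M(T_v\dot{\mathbf{Y}}_{t,t})$, $\mathbf{W}_0=\mathbf{1}$, is an $M$-sgrp; writing $\mathcal{T}_v[\mathbf{Y}]_{s,t}:=\mathbf{W}_s^{-1}\otimes_M\mathbf{W}_t$ for its associated $M$-sgrm, one has $$\mathcal{T}_v[\mathbf{Y}]_{s,t}=T_v^M(\mathbf{Y}^M_{s,t})=\mathrm{proj}_M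 T_v(\mathbf{X}_{s,t}),$$ where $T_v^M:=\mathrm{proj}_M\circ T_v\circ\mathfrak{i}^M$ is an algebra endomorphism of $(T^M(\mathbb{R}^d),\otimes_M)$, $\mathfrak{i}^M:T^M(\mathbb{R}^d)\to T((\mathbb{R}^d))$ is the linear embedding, and $\mathbf{Y}^M=\mathrm{proj}_M\mathrm{MinExt}(\mathbf{Y})$.
   Context: Fix $T>0$, $d\ge1$. $T((\mathbb{R}^d))$: formal tensor series over words in $\{1,\dots,d\}$ (incl. empty word, unit $\mathbf{1}$), concatenation $\otimes$; $\langle\mathbf{x},w\rangle$ coefficient of $w$. $T^N(\mathbb{R}^d)$: span of words of length $\le N$, quotient algebra with product $\otimes_N$, projection $\mathrm{proj}_N$. Shuffle: bilinear, unit $\mathbf{1}$, $wi\sqcup\!\sqcup vj=(w\sqcup\!\sqcup vj)i+(wi\sqcup\!\sqcup v)j$. $G(\mathbb{R}^d)$: series with $\langle\mathbf{x},\mathbf{1}\rangle=1$ and $\langle\mathbf{x},v\sqcup\!\sqcup w\rangle=\langle\mathbf{x},v\rangle\langle\mathbf{x},w\rangle$. $\mathcal{L}(\mathbb{R}^d)$ Lie polynomials generated by $e_1,\dots,e_d$; $\mathcal{L}^N(\mathbb{R}^d)=\mathrm{proj}_N\mathcal{L}(\mathbb{R}^d)$; $\mathcal{L}((\mathbb{R}^d))$ Lie series. For $v=(v_1,\dots,v_d)\subset\mathcal{L}((\mathbb{R}^d))$, $T_v$ is the $\otimes$-algebra endomorphism of $T((\mathbb{R}^d))$ (continuous for coordinatewise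 convergence) extending $e_i\mapsto e_i+v_i$. $N$-sgrp: non-zero path $\mathbf{X}:[0,T]\to T^N(\mathbb{R}^d)$ with $\langle\mathbf{X}_t,v\sqcup\!\sqcup w\rangle=\langle\mathbf{X}_t,v\rangle\langle\mathbf{X}_t,w\rangle$ ($|v|+|w|\le N$) and smooth coordinates; sgrp: same in $T((\mathbb{R}^d))$ for all words. $N$-sgrm: non-zero $\mathbf{X}:[0,T]^2\to T^N(\mathbb{R}^d)$ with the shuffle relation for each $\mathbf{X}_{s,t}$, $\mathbf{X}_{s,u}\otimes_N\mathbf{X}_{u,t}=\mathbf{X}_{s,t}$, and smooth $t\mapsto\langle\mathbf{X}_{s,t},w\rangle$; sgrm: same in $T((\mathbb{R}^d))$ with $\otimes$. A path determines a model via $\mathbf{X}_{s,t}=\mathbf{X}_s^{-1}\otimes\mathbf{X}_t$ (resp. $\otimes_N$). Diagonal derivative $\dot{\mathbf{X}}_{s,s}=\partial_t|_{t=s}\mathbf{X}_{s,t}$. $\mathrm{MinExt}(\mathbf{Y})$ of an $N$-sgrm $\mathbf{Y}$: the unique sgrm agreeing with $\mathbf{Y}$ on words of length $\le N$ with diagonal derivative in $\mathcal{L}^N(\mathbb{R}^d)$ for all times. An sgrm is good if it equals $\mathrm{MinExt}(\mathbf{Y})$ for some $N$ and some $N$-sgrm $\mathbf{Y}$. *)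

(* Defs.v *)
From HB Require Import structures.
From mathcomp Require Import all_boot all_order all_algebra.
From mathcomp Require Import all_classical all_reals all_analysis.
Set Implicit Arguments. Unset Strict Implicit. Unset Printing Implicit Defensive.
Import Order.TTheory GRing.Theory Num.Theory.
Import numFieldNormedType.Exports.
Local Open Scope classical_set_scope.
Local Open Scope ring_scope.

Fixpoint shl (A : Type) (u v : seq A) : seq (seq A) :=
  match u with
  | [::] => [:: v]
  | i :: u' =>
    let fix aux (v : seq A) : seq (seq A) :=
      match v with
      | [::] => [:: u]
      | j :: v' => map (cons i) (shl u' v) ++ map (cons j) (aux v')
      end in aux v
  end.

(* Shuffle with the paper's last-letter recursion:
   wi sh vj = (w sh vj) i + (wi sh v) j, obtained by reversing words.
   The shuffle product u sh v is the formal sum of the (multi)list below. *)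
Definition shuffle (A : Type) (u v : seq A) : seq (seq A) :=
  map rev (shl (rev u) (rev v)).

Section TensorSeries.
Variables (R : realType) (d : nat).

Definition word := seq 'I_d.
Definition tseries := word -> R.

Definition szero : tseries := fun _ => 0.
Definition sone : tseries := fun w => if w is [::] then 1 else 0.
Definition letter (i : 'I_d) : tseries := fun w => if w == [:: i] then 1 else 0.
Definition sadd (x y : tseries) : tseries := fun w => x w + y w.
Definition ssub (x y : tseries) : tseries := fun w => x w - y w.
Definition sscale (a : R) (x : tseries) : tseries := fun w => a * x w.

Definition tprod (x y : tseries) : tseries :=
  fun w => \sum_(k < (size w).+1) x (take k w) * y (drop k w).

Definition spow (x : tseries) (n : nat) : tseries := iter n (tprod x) sone.

Definition tproj (N : nat) (x : tseries) : tseries :=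
  fun w => if (size w <= N)%N then x w else 0.
Definition tprodN (N : nat) (x y : tseries) : tseries := tproj N (tprod x y).
Definition inTN (N : nat) (x : tseries) : Prop := x = tproj N x.

(* inverse of a tseries with unit constant term: sum_n (1 - x)^n *)
Definition sinv (x : tseries) : tseries :=
  fun w => \sum_(n < (size w).+1) spow (ssub sone x) n w.
Definition invN (N : nat) (x : tseries) : tseries := tproj N (sinv x).

Definition pair_sh (x : tseries) (u v : word) : R :=
  \sum_(w <- shuffle u v) x w.
Definition shuffle_rel (x : tseries) : Prop :=
  forall u v : word, pair_sh x u v = x u * x v.
Definition shuffle_relN (N : nat) (x : tseries) : Prop :=
  forall u v : word, (size u + size v <= N)%N -> pair_sh x u v = x u * x v.

Definition in_G (x : tseries) : Prop := x [::] = 1 /\ shuffle_rel x.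

Inductive is_lie_poly : tseries -> Prop :=
| lie_zero : is_lie_poly szero
| lie_gen i : is_lie_poly (letter i)
| lie_add x y : is_lie_poly x -> is_lie_poly y -> is_lie_poly (sadd x y)
| lie_scale a x : is_lie_poly x -> is_lie_poly (sscale a x)
| lie_bracket x y : is_lie_poly x -> is_lie_poly y ->
    is_lie_poly (ssub (tprod x y) (tprod y x)).

Definition homog (n : nat) (x : tseries) : tseries :=
  fun w => if size w == n then x w else 0.
Definition is_lie_series (x : tseries) : Prop := forall n, is_lie_poly (homog n x).
Definition in_LieN (N : nat) (x : tseries) : Prop :=
  exists p, is_lie_poly p /\ x = tproj N p.

(* T_v : the continuous algebra endomorphism extending e_i |-> e_i + v_i.
   Since each e_i + v_i has no constant term, the coefficient of u in
   T_v x only involves words w of length <= |u|: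
   <T_v x, u> = sum_{|w| <= |u|} <x,w> <(e_{w1}+v_{w1}) ... (e_{wk}+v_{wk}), u>. *)
Definition img_word (v : 'I_d -> tseries) (w : word) : tseries :=
  foldr (fun i acc => tprod (sadd (letter i) (v i)) acc) sone w.
Definition Tv (v : 'I_d -> tseries) (x : tseries) : tseries :=
  fun u => \sum_(k < (size u).+1) \sum_(w : k.-tuple 'I_d)
             x (tval w) * img_word v (tval w) u.
(* T_v^M := proj_M o T_v o i^M  (i^M is the identity in our representation) *)
Definition TvM (M : nat) (v : 'I_d -> tseries) (x : tseries) : tseries :=
  tproj M (Tv v x).

Definition deriv_within (T : R) (f : R -> R) (s l : R) : Prop :=
  (fun t => (f t - f s) / (t - s)) @
     within [set t | t != s /\ 0 <= t <= T] (nbhs s) --> l.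

Definition smooth_on (T : R) (f : R -> R) : Prop :=
  exists F : nat -> R -> R,
    (forall t, 0 <= t <= T -> F 0%N t = f t) /\
    (forall n s, 0 <= s <= T -> deriv_within T (F n) s (F n.+1 s)).

Definition is_sgrp (T : R) (X : R -> tseries) : Prop :=
  (exists t, 0 <= t <= T /\ X t <> szero) /\
  (forall t, 0 <= t <= T -> shuffle_rel (X t)) /\
  (forall w, smooth_on T (fun t => X t w)).

Definition is_Nsgrp (T : R) (N : nat) (X : R -> tseries) : Prop :=
  (exists t, 0 <= t <= T /\ X t <> szero) /\
  (forall t, 0 <= t <= T -> inTN N (X t)) /\
  (forall t, 0 <= t <= T -> shuffle_relN N (X t)) /\
  (forall w, smooth_on T (fun t => X t w)).

Definition is_sgrm (T : R) (X : R -> R -> tseries) : Prop :=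
  (exists s t, 0 <= s <= T /\ 0 <= t <= T /\ X s t <> szero) /\
  (forall s t, 0 <= s <= T -> 0 <= t <= T -> shuffle_rel (X s t)) /\
  (forall s u t, 0 <= s <= T -> 0 <= u <= T -> 0 <= t <= T ->
     tprod (X s u) (X u t) = X s t) /\
  (forall s w, 0 <= s <= T -> smooth_on T (fun t => X s t w)).

Definition is_Nsgrm (T : R) (N : nat) (X : R -> R -> tseries) : Prop :=
  (exists s t, 0 <= s <= T /\ 0 <= t <= T /\ X s t <> szero) /\
  (forall s t, 0 <= s <= T -> 0 <= t <= T -> inTN N (X s t)) /\
  (forall s t, 0 <= s <= T -> 0 <= t <= T -> shuffle_relN N (X s t)) /\
  (forall s u t, 0 <= s <= T -> 0 <= u <= T -> 0 <= t <= T ->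
     tprodN N (X s u) (X u t) = X s t) /\
  (forall s w, 0 <= s <= T -> smooth_on T (fun t => X s t w)).

Definition pmodel (X : R -> tseries) : R -> R -> tseries :=
  fun s t => tprod (sinv (X s)) (X t).
Definition pmodelN (N : nat) (X : R -> tseries) : R -> R -> tseries :=
  fun s t => tprodN N (invN N (X s)) (X t).

Definition diag_deriv (T : R) (X : R -> R -> tseries) (s : R) (D : tseries) : Prop :=
  forall w, deriv_within T (fun t => X s t w) s (D w).

Definition is_MinExt (T : R) (N : nat) (Y X : R -> R -> tseries) : Prop :=
  is_sgrm T X /\
  (forall s t, 0 <= s <= T -> 0 <= t <= T -> tproj N (X s t) = tproj N (Y s t)) /\
  (forall s, 0 <= s <= T -> exists D, diag_deriv T X s D /\ in_LieN N D).

Definition is_good (T : R) (X : R -> R -> tseries) : Prop :=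
  exists N Y, is_Nsgrm T N Y /\ is_MinExt T N Y X.

Definition solves (T : R) (v : 'I_d -> tseries) (Xm : R -> R -> tseries)
  (Z0 : tseries) (Z : R -> tseries) : Prop :=
  Z 0 = Z0 /\
  forall t, 0 <= t <= T -> exists D, diag_deriv T Xm t D /\
    forall w, deriv_within T (fun r => Z r w) t (tprod (Z t) (Tv v D) w).

Definition solvesN (T : R) (M : nat) (v : 'I_d -> tseries) (Ym : R -> R -> tseries)
  (W : R -> tseries) : Prop :=
  (forall t, 0 <= t <= T -> inTN M (W t)) /\
  W 0 = sone /\
  forall t, 0 <= t <= T -> exists D, diag_deriv T Ym t D /\
    forall w, deriv_within T (fun r => W r w) t (tprodN M (W t) (Tv v D) w).

End TensorSeries.

(* Main.v *)
(** A group-like series [x] is one whose image under the coproduct dual to the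
    shuffle product is [x (x) x]; Lie series are primitive for this coproduct.
    [T_v] is an algebra morphism sending each letter to a primitive series, so it
    commutes with the coproduct and preserves group-like series.  Being a morphism,
    it sends [X_r = X_t X_{t,r}] to [T_v X_r = (T_v X_t) (T_v X_{t,r})], and
    differentiating at [r = t] shows that [T_v X] solves the linear equation;
    uniqueness holds because that equation is triangular in the length of words.
    In the polynomial case the diagonal derivative lies in [L^N] and is shared by
    [Y] and [X], and [T_v] multiplies its degree by at most [max(1,N')]. *)

Require Import Defs.
From HB Require Import structures.
From mathcomp Require Import all_boot all_order all_algebra.
From mathcomp Require Import all_classical all_reals all_analysis.
From mathcomp Require Import ring lra.
Import Order.TTheory GRing.Theory Num.Theory.
Local Open Scope ring_scope.
Set Implicit Arguments. Unset Strict Implicit. Unset Printing Implicit Defensive.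

(** * Unshuffles *)

Section Unshuffle.
Variable A : eqType.
Implicit Types (u v w : seq A) (p q : seq A * seq A).

(** Existence needs no theory of differential equations, since the solution is explicit; only
    uniqueness does. The difficulties lie elsewhere. The shuffle of the definitions recurses on last
    letters, while concatenation unfolds most easily on first letters; the two are reconciled
    through [unshuffle], the list of splittings of a word into two complementary subwords, which is
    the coproduct in coordinates. Series are infinite, so identities are checked up to a degree with
    [agree]; this works because the [v i], being primitive, have no constant term, so substitution
    never lowers degree. Finally, a signature is assumed non-zero only somewhere: its constant term
    is always 0 or 1, and continuity for paths, or Chen's relation for models, makes it 1
    everywhere, which is what permits inversion. *)

Lemma shl0r u : shl u [::] = [:: u].
Proof. by case: u. Qed.

(** Each letter goes to one of the two components; repeated pairs are kept, so multiplicities are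
    the coefficients of the coproduct. *)
Fixpoint unshuffle w : seq (seq A * seq A) :=
  if w is i :: w' then
    [seq (i :: p.1, p.2) | p <- unshuffle w'] ++
    [seq (p.1, i :: p.2) | p <- unshuffle w']
  else [:: ([::], [::])].

Lemma count_mem_map_cons (i : A) w (s : seq (seq A)) :
  count_mem w (map (cons i) s) =
    if w is j :: w' then if i == j then count_mem w' s else 0%N else 0%N.
Proof.
rewrite count_map; case: w => [|j w].
  by rewrite (eq_count (a2 := pred0)) ?count_pred0.
case: (eqVneq i j) => [->|nij].
  by apply: eq_count => x; rewrite /= eqseq_cons eqxx.
rewrite (eq_count (a2 := pred0)) ?count_pred0 // => x.
by rewrite /= eqseq_cons (negbTE nij).
Qed.

Lemma count_unshuffle_cons (i : A) w u v :
  count_mem (u, v) (unshuffle (i :: w)) =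
  ((if u is j :: u' then if i == j then count_mem (u', v) (unshuffle w) else 0 else 0)
  + (if v is j :: v' then if i == j then count_mem (u, v') (unshuffle w) else 0 else 0))%N.
Proof.
rewrite /= count_cat !count_map; congr (_ + _)%N.
- case: u => [|j u].
    by rewrite (eq_count (a2 := pred0)) ?count_pred0.
  case: (eqVneq i j) => [->|nij].
    by apply: eq_count => -[a b]; rewrite /= !xpair_eqE eqseq_cons eqxx.
  rewrite (eq_count (a2 := pred0)) ?count_pred0 // => -[a b].
  by rewrite /= xpair_eqE eqseq_cons (negbTE nij).
- case: v => [|j v].
    by rewrite (eq_count (a2 := pred0)) ?count_pred0 // => -[a b] /=; rewrite xpair_eqE andbF.
  case: (eqVneq i j) => [->|nij].
    by apply: eq_count => -[a b]; rewrite /= !xpair_eqE eqseq_cons eqxx.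
  rewrite (eq_count (a2 := pred0)) ?count_pred0 // => -[a b].
  by rewrite /= xpair_eqE eqseq_cons (negbTE nij) andbF.
Qed.

(** The first letter of [w] comes from either [u] or [v], so both multiplicities obey one recursion;
    this is the duality of shuffle and coproduct. *)
Lemma count_shl_unshuffle w u v :
  count_mem w (shl u v) = count_mem (u, v) (unshuffle w).
Proof.
elim: w u v => [|i w IH] [|j u] [|l v]; rewrite ?count_unshuffle_cons.
- by [].
- by [].
- by [].
- by rewrite /= count_cat !count_mem_map_cons.
- by [].
- by rewrite -IH /= !addn0 eqseq_cons [l == i]eq_sym; case: eqP.
- by rewrite -IH !shl0r /= !addn0 eqseq_cons [j == i]eq_sym; case: eqP.
- rewrite -!IH /= count_cat !count_mem_map_cons.
  by rewrite ![_ == i]eq_sym.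
Qed.

Lemma perm_unshuffle_rcons w (i : A) :
  perm_eq (unshuffle (rcons w i))
    ([seq (rcons p.1 i, p.2) | p <- unshuffle w] ++
     [seq (p.1, rcons p.2 i) | p <- unshuffle w]).
Proof.
elim: w => [|j w IH] //=.
apply: perm_trans (perm_cat (perm_map _ IH) (perm_map _ IH)) _.
rewrite !map_cat perm_catACA -!map_comp; exact: perm_refl.
Qed.

Lemma perm_unshuffle_rev w :
  perm_eq (unshuffle (rev w)) [seq (rev p.1, rev p.2) | p <- unshuffle w].
Proof.
elim: w => [|i w IH] //=; rewrite rev_cons.
apply: perm_trans (perm_unshuffle_rcons _ _) _.
apply: perm_trans (perm_cat (perm_map _ IH) (perm_map _ IH)) _.
rewrite map_cat -!map_comp.
apply/permP => a; rewrite !count_cat !count_map.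
by congr (_ + _)%N; apply: eq_count => p /=; rewrite rev_cons.
Qed.

(** Splitting a word visibly commutes with reversal, whereas the recursion of [shl] is one-sided;
    hence the detour through [unshuffle]. *)
Lemma perm_shuffle_shl u v : perm_eq (shuffle u v) (shl u v).
Proof.
apply/allP => w _ /=; rewrite /shuffle count_map.
rewrite (eq_count (a2 := pred1 (rev w))); last first.
  by move=> x /=; rewrite -(inj_eq (can_inj (@revK A))) revK.
rewrite !count_shl_unshuffle (permP (perm_unshuffle_rev w)) count_map.
apply/eqP/eq_count => -[a b] /=.
by rewrite !xpair_eqE !(inj_eq (can_inj (@revK A))).
Qed.

Lemma size_shl u v w : w \in shl u v -> size w = (size u + size v)%N.
Proof.
elim: u v w => [|i u IHu] v w; first by rewrite inE => /eqP ->.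
elim: v w => [|j v IHv] w; first by rewrite inE addn0 => /eqP ->.
rewrite mem_cat => /orP[] /mapP[x xin ->] /=.
  by rewrite (IHu _ _ xin).
by rewrite (IHv _ xin) addnS.
Qed.

End Unshuffle.

(** * The algebra of tensor series *)

Section Series.
Variables (R : realType) (d : nat).
Local Notation word := (word d).
Local Notation tseries := (tseries R d).
Implicit Types (x y z f g : tseries) (u w : word) (i j : 'I_d) (a b : R).

(** The left (Brzozowski) derivative by a letter, which gives first-letter recursions for products,
    pairings and substitution. *)
Definition lquot i x : tseries := fun w => x (i :: w).

Definition agree n x y := forall w, (size w <= n)%N -> x w = y w.

Lemma agree_tproj n x y : agree n x y <-> tproj n x = tproj n y.
Proof.
split=> [h|h w wn].
  by apply/funext => w; rewrite /tproj; case: ifP => // /h.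
by move/(congr1 (fun z => z w)): h; rewrite /tproj wn.
Qed.

Lemma agree_tprojl n x : agree n (tproj n x) x.
Proof. by move=> w wn; rewrite /tproj wn. Qed.

Lemma agree_sym n x y : agree n x y -> agree n y x.
Proof. by move=> h w /h. Qed.

Lemma agree_trans n x y z : agree n x y -> agree n y z -> agree n x z.
Proof. by move=> h k w wn; rewrite h // k. Qed.

Lemma agree_all x y : (forall n, agree n x y) -> x = y.
Proof. by move=> h; apply/funext => w; apply: (h (size w)). Qed.

Lemma tproj_id n x : tproj n (tproj n x) = tproj n x.
Proof. exact/agree_tproj/agree_tprojl. Qed.

Lemma tprod_nil x y : tprod x y [::] = x [::] * y [::].
Proof. by rewrite /tprod big_ord1. Qed.

Lemma tprod_cons x y i w :
  tprod x y (i :: w) = x [::] * y (i :: w) + tprod (lquot i x) y w.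
Proof. by rewrite /tprod big_ord_recl. Qed.

Lemma tprod_addl x y z w : tprod (sadd x y) z w = tprod x z w + tprod y z w.
Proof. by rewrite -big_split; apply: eq_bigr => k _; rewrite mulrDl. Qed.

Lemma tprod_addr x y z w : tprod x (sadd y z) w = tprod x y w + tprod x z w.
Proof. by rewrite -big_split; apply: eq_bigr => k _; rewrite mulrDr. Qed.

Lemma tprod_subl x y z w : tprod (ssub x y) z w = tprod x z w - tprod y z w.
Proof. by rewrite -sumrB; apply: eq_bigr => k _; rewrite mulrBl. Qed.

Lemma tprod_subr x y z w : tprod x (ssub y z) w = tprod x y w - tprod x z w.
Proof. by rewrite -sumrB; apply: eq_bigr => k _; rewrite mulrBr. Qed.

Lemma tprod_scalel a x y w : tprod (sscale a x) y w = a * tprod x y w.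
Proof. by rewrite mulr_sumr; apply: eq_bigr => k _; rewrite mulrA. Qed.

Lemma tprod_scaler a x y w : tprod x (sscale a y) w = a * tprod x y w.
Proof. by rewrite mulr_sumr; apply: eq_bigr => k _; rewrite mulrCA. Qed.

Lemma tprod_suml (I : Type) (r : seq I) (F : I -> tseries) y w :
  tprod (fun u => \sum_(i <- r) F i u) y w = \sum_(i <- r) tprod (F i) y w.
Proof.
by rewrite exchange_big; apply: eq_bigr => k _; rewrite mulr_suml.
Qed.

Lemma tprod_sumr (I : Type) (r : seq I) x (F : I -> tseries) w :
  tprod x (fun u => \sum_(i <- r) F i u) w = \sum_(i <- r) tprod x (F i) w.
Proof.
by rewrite exchange_big; apply: eq_bigr => k _; rewrite mulr_sumr.
Qed.

Lemma tprod0l y w : tprod (@szero R d) y w = 0.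
Proof. by rewrite /tprod big1 // => k _; rewrite mul0r. Qed.

Lemma tprod0r y w : tprod y (@szero R d) w = 0.
Proof. by rewrite /tprod big1 // => k _; rewrite mulr0. Qed.

Lemma tprod1l y : tprod (@sone R d) y = y.
Proof.
apply/funext => -[|i w]; rewrite ?tprod_nil ?tprod_cons /= mul1r //.
by rewrite -[X in _ + X]/(tprod (@szero R d) y w) tprod0l addr0.
Qed.

Lemma tprod1r y : tprod y (@sone R d) = y.
Proof.
apply/funext => w; elim: w y => [|i w IH] y; rewrite ?tprod_nil ?tprod_cons /=.
  by rewrite mulr1.
by rewrite IH mulr0 add0r.
Qed.

Lemma lquot_tprod i x y :
  lquot i (tprod x y) = sadd (sscale (x [::]) (lquot i y)) (tprod (lquot i x) y).
Proof. by apply/funext => w; rewrite /lquot tprod_cons. Qed.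

Lemma tprodA x y z : tprod x (tprod y z) = tprod (tprod x y) z.
Proof.
apply/funext => w; elim: w x y z => [|i w IH] x y z.
  by rewrite !tprod_nil mulrA.
rewrite !tprod_cons lquot_tprod tprod_addl tprod_scalel -IH tprod_nil.
by rewrite mulrDr !mulrA addrA.
Qed.

Lemma agree_tprod n x x' y y' :
  agree n x x' -> agree n y y' -> agree n (tprod x y) (tprod x' y').
Proof.
move=> hx hy w wn; apply: eq_bigr => k _; rewrite hx ?hy //.
  by rewrite size_drop (leq_trans (leq_subr _ _)).
by rewrite size_take_min (leq_trans (geq_minr _ _)).
Qed.

(** A left factor without constant term consumes at least one letter. This gain of one degree makes
    the later recursions contracting: [spow_small], [img_word_small] and [Tv_tprod] rest on it. *)
Lemma agree_tprod_shift n f x y : f [::] = 0 -> agree n x y ->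
  agree n.+1 (tprod f x) (tprod f y).
Proof.
move=> f0 h [|i w] wn; first by rewrite !tprod_nil f0 !mul0r.
by rewrite !tprod_cons f0 !mul0r !add0r; apply: (agree_tprod _ h wn).
Qed.

Lemma agree_sub n x x' y y' :
  agree n x x' -> agree n y y' -> agree n (ssub x y) (ssub x' y').
Proof. by move=> hx hy w wn; rewrite /ssub hx ?hy. Qed.

Lemma agree_spow n x y k : agree n x y -> agree n (spow x k) (spow y k).
Proof. by move=> h; elim: k => [|k IH] //=; apply: agree_tprod. Qed.

Lemma agree_sinv n x y : agree n x y -> agree n (sinv x) (sinv y).
Proof.
move=> h w wn; apply: eq_bigr => k _; apply: (agree_spow k _ wn).
exact: agree_sub.
Qed.

Lemma spow_small x k w : x [::] = 0 -> (size w < k)%N -> spow x k w = 0.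
Proof.
move=> x0; elim: k w => [|k IH] w wk //=.
rewrite -(tprod0r x w).
case: w wk => [|i w] wk; first by rewrite !tprod_nil x0 !mul0r.
by apply: (agree_tprod_shift (n := (size w)) x0) => // u un; apply: IH; apply: leq_ltn_trans un _.
Qed.

Lemma spowSr x k : spow x k.+1 = tprod (spow x k) x.
Proof.
elim: k => [|k IH]; first by rewrite /= tprod1l tprod1r.
by rewrite -[LHS]/(tprod x (spow x k.+1)) {1}IH tprodA.
Qed.

(** The cutoff in [sinv] moves with the word; a common cutoff gives one finite sum of series, to
    which linearity of the product applies. *)
Lemma sinv_widen n x w : x [::] = 1 -> (size w <= n)%N ->
  sinv x w = \sum_(k < n.+1) spow (ssub (@sone R d) x) k w.
Proof.
move=> x1 wn.
rewrite /sinv (big_ord_widen n.+1 (fun k => spow (ssub (@sone R d) x) k w)) //.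
rewrite big_mkcond; apply: eq_bigr => k _; case: ltnP => // h.
by rewrite spow_small // /ssub /= x1 subrr.
Qed.

Lemma ssubKone x : x = ssub (@sone R d) (ssub (@sone R d) x).
Proof. by apply/funext => w; rewrite /ssub opprB addrC subrK. Qed.

Lemma telescope_ord (F : nat -> R) n :
  \sum_(k < n) (F k - F k.+1) = F 0%N - F n.
Proof.
by elim: n => [|n IH]; rewrite ?big_ord0 ?subrr // big_ord_recr /= IH subrKA.
Qed.

Lemma sinvl x : x [::] = 1 -> tprod (sinv x) x = @sone R d.
Proof.
move=> x1; apply/funext => w; set e := ssub (@sone R d) x.
have e0 : e [::] = 0 by rewrite /e /ssub /= x1 subrr.
(* The cutoff is frozen at the length of [w], so the geometric sum telescopes to the unit minus a
   power that vanishes at [w]. *)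
pose S u := \sum_(k < (size w).+1) spow e k u.
have -> : tprod (sinv x) x w = tprod S x w.
  by apply: (agree_tprod (n := size w)) => // u un; apply: sinv_widen.
rewrite [X in tprod _ X](ssubKone x) tprod_subr tprod1r -/e /S.
rewrite (tprod_suml _ (fun k : 'I__ => spow e k)) -sumrB.
rewrite (eq_bigr (fun k : 'I__ => spow e k w - spow e k.+1 w)); last first.
  by move=> k _; rewrite spowSr.
rewrite (telescope_ord (fun k => spow e k w)).
by rewrite (spow_small e0 (ltnSn _)) subr0.
Qed.

Lemma sinvr x : x [::] = 1 -> tprod x (sinv x) = @sone R d.
Proof.
move=> x1; apply/funext => w; set e := ssub (@sone R d) x.
have e0 : e [::] = 0 by rewrite /e /ssub /= x1 subrr.
pose S u := \sum_(k < (size w).+1) spow e k u.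
have -> : tprod x (sinv x) w = tprod x S w.
  by apply: (agree_tprod (n := size w)) => // u un; apply: sinv_widen.
rewrite [X in tprod X _](ssubKone x) tprod_subl tprod1l -/e /S.
rewrite (tprod_sumr _ _ (fun k : 'I__ => spow e k)) -sumrB.
rewrite (eq_bigr (fun k : 'I__ => spow e k w - spow e k.+1 w)) //.
rewrite (telescope_ord (fun k => spow e k w)).
by rewrite (spow_small e0 (ltnSn _)) subr0.
Qed.

Lemma sinv_eq x y : x [::] = 1 -> tprod y x = @sone R d -> sinv x = y.
Proof. by move=> x1 h; rewrite -[LHS]tprod1l -h -tprodA sinvr // tprod1r. Qed.

(** * Shuffle pairing, primitive and group-like series *)

(** The coefficient at [u] tensor [w] of the coproduct of [x]. *)
Definition shpair x u w := \sum_(t <- shl u w) x t.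

Lemma pair_shE x u w : pair_sh x u w = shpair x u w.
Proof. by apply: perm_big; apply: perm_shuffle_shl. Qed.

Lemma shpair0l x w : shpair x [::] w = x w.
Proof. by rewrite /shpair big_seq1. Qed.

Lemma shpair0r x u : shpair x u [::] = x u.
Proof. by rewrite /shpair shl0r big_seq1. Qed.

Lemma shpair_cons x i u j w :
  shpair x (i :: u) (j :: w) =
  shpair (lquot i x) u (j :: w) + shpair (lquot j x) (i :: u) w.
Proof. by rewrite /shpair /= big_cat !big_map. Qed.

Lemma shpair_add x y u w : shpair (sadd x y) u w = shpair x u w + shpair y u w.
Proof. exact: big_split. Qed.

Lemma shpair_scale a x u w : shpair (sscale a x) u w = a * shpair x u w.
Proof. by rewrite /shpair mulr_sumr. Qed.

Lemma shpair_sub x y u w : shpair (ssub x y) u w = shpair x u w - shpair y u w.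
Proof. exact: sumrB. Qed.

Lemma agree_shpair n x y u w : (size u + size w <= n)%N -> agree n x y ->
  shpair x u w = shpair y u w.
Proof.
move=> uwn h; rewrite /shpair !big_seq; apply: eq_bigr => t /size_shl ts.
by apply: h; rewrite ts.
Qed.

(** Multiplicativity of the coproduct: cutting a shuffle of [u] and [w] cuts both words, leaving a
    shuffle of the prefixes and one of the suffixes. *)
Lemma shpair_tprod x y u w :
  shpair (tprod x y) u w =
  \sum_(k < (size u).+1) \sum_(l < (size w).+1)
    shpair x (take k u) (take l w) * shpair y (drop k u) (drop l w).
Proof.
elim: u w x y => [|i u IHu] w x y.
  by rewrite big_ord1 /= shpair0l; apply: eq_bigr => l _; rewrite !shpair0l.
elim: w x y => [|j w IHw] x y.
  rewrite shpair0r; apply: eq_bigr => k _.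
  by rewrite big_ord1 /= !shpair0r.
rewrite shpair_cons !lquot_tprod !shpair_add !shpair_scale IHu IHw.
(* The two empty-prefix contributions merge into the term with both cuts at 0; the rest is sorted by
   whether the shuffled prefix starts with [i] or with [j]. *)
rewrite addrACA -mulrDr -shpair_cons.
rewrite [RHS]big_ord_recl [X in _ = X + _]big_ord_recl /= shpair0l -addrA.
congr (_ + _).
rewrite addrC.
rewrite big_ord_recl -addrA; congr (_ + _).
  by apply: eq_bigr => l _; rewrite !shpair0l.
rewrite -big_split; apply: eq_bigr => k _ /=.
rewrite addrC big_ord_recl [RHS]big_ord_recl /= !shpair0r -addrA; congr (_ + _).
by rewrite -big_split; apply: eq_bigr => l _; rewrite /= shpair_cons mulrDl.
Qed.

Definition primitive x :=
  forall u w, shpair x u w = x u * @sone R d w + @sone R d u * x w.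

Lemma primitive0 x : primitive x -> x [::] = 0.
Proof.
move=> /(_ [::] [::]); rewrite shpair0l /= mulr1 mul1r => h.
by apply: (@addrI _ (x [::])); rewrite addr0 -h.
Qed.

(** The coproduct of a primitive [x] is [x] tensor 1 plus 1 tensor [x], so it multiplies one
    component at a time while the other word stays a parameter. *)
Lemma primitive_shpair_tprod x y u w : primitive x ->
  shpair (tprod x y) u w =
  tprod x (fun t => shpair y t w) u + tprod x (fun t => shpair y u t) w.
Proof.
move=> px; rewrite shpair_tprod.
under eq_bigr do under eq_bigr do rewrite px mulrDl.
under eq_bigr do rewrite big_split /=.
rewrite big_split /=; congr (_ + _).
  apply: eq_bigr => k _.
  rewrite (eq_bigr (fun l : 'I__ => x (take k u) *
    (@sone R d (take l w) * shpair y (drop k u) (drop l w)))); last first.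
    by move=> l _; rewrite mulrA.
  rewrite -mulr_sumr; congr (_ * _).
  by rewrite -[RHS](congr1 (fun z => z w) (tprod1l (fun t => shpair y (drop k u) t))).
rewrite exchange_big; apply: eq_bigr => l _ /=.
rewrite (eq_bigr (fun k : 'I__ => x (take l w) *
  (@sone R d (take k u) * shpair y (drop k u) (drop l w)))); last first.
  by move=> k _; rewrite mulrA [x _ * _]mulrC.
rewrite -mulr_sumr; congr (_ * _).
by rewrite -[RHS](congr1 (fun z => z u) (tprod1l (fun t => shpair y t (drop l w)))).
Qed.

(** The mixed terms are symmetric in [x] and [y] and cancel in the commutator: this is why primitive
    series are closed under brackets. *)
Lemma shpair_tprod_primitive x y u w : primitive x -> primitive y ->
  shpair (tprod x y) u w =
  tprod x y u * @sone R d w + x u * y w + y u * x w + @sone R d u * tprod x y w.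
Proof.
move=> px py; rewrite primitive_shpair_tprod //.
have -> : (fun t => shpair y t w) =
    sadd (sscale (@sone R d w) y) (sscale (y w) (@sone R d)).
  by apply/funext => t; rewrite py /sadd /sscale mulrC [_ * y w]mulrC.
have -> : (fun t => shpair y u t) =
    sadd (sscale (y u) (@sone R d)) (sscale (@sone R d u) y).
  by apply/funext => t; rewrite py.
rewrite !tprod_addr !tprod_scaler tprod1r addrA.
by rewrite [_ * tprod x y u]mulrC [y w * _]mulrC.
Qed.

(** A shuffle of two non-empty words has at least two letters, where a letter series vanishes. *)
Lemma primitive_letter i : primitive (@letter R d i).
Proof.
move=> [|j u] w; first by rewrite shpair0l /letter /= mul0r add0r mul1r.
case: w => [|k w]; first by rewrite shpair0r /= mulr1 mul0r addr0.
rewrite /= mulr0 mul0r addr0 /shpair big_seq big1 // => t /size_shl ts.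
rewrite /letter; case: eqP => // tE; move: ts; rewrite tE /=.
by rewrite addSn addnS.
Qed.

Lemma primitive_lie_poly x : is_lie_poly x -> primitive x.
Proof.
elim=> {x} [|i|x y _ px _ py|a x _ px|x y _ px _ py] u w.
- by rewrite /shpair big1 // /szero mul0r mulr0 addr0.
- exact: primitive_letter.
- by rewrite shpair_add px py /sadd mulrDl mulrDr addrACA.
- by rewrite shpair_scale px /sscale mulrDr mulrA [a * (_ * x w)]mulrCA.
- rewrite shpair_sub !shpair_tprod_primitive // /ssub mulrBl mulrBr.
  ring.
Qed.
End Series.

(** * The substitution morphism *)

Section Substitution.
Variables (R : realType) (d : nat).
Local Notation word := (word d).
Local Notation tseries := (tseries R d).
Implicit Types (x y z f g : tseries) (u w : word) (i j : 'I_d) (a b : R).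

(** A list with a freely chosen length bound, replacing the tuples of each length in [Tv]: several
    coefficients can then be expanded over a common range. *)
Fixpoint words (n : nat) : seq word :=
  if n is m.+1 then [::] :: [seq i :: w | i <- enum 'I_d, w <- words m]
  else [:: [::]].

Lemma big_wordsS n (F : word -> R) :
  \sum_(w <- words n.+1) F w =
  F [::] + \sum_(i < d) \sum_(w <- words n) F (i :: w).
Proof. by rewrite big_cons big_allpairs_dep big_enum. Qed.

Lemma mem_words n w : (w \in words n) = (size w <= n)%N.
Proof.
elim: n w => [|n IH] [|i w] //=; rewrite inE /=.
apply/allpairsP/idP => [[[j t] /= [_ tn [_ ->]]]|wn]; first by rewrite ltnS -IH.
by exists (i, w); rewrite mem_enum IH.
Qed.

Lemma words_uniq n : uniq (words n).
Proof.
elim: n => [|n IH] //=; apply/andP; split.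
  by apply/negP => /allpairsP[[j t] [_ _]].
by apply: allpairs_uniq; rewrite ?enum_uniq // => -[i w] [j t] _ _ [-> ->].
Qed.

Lemma sum_words_count n (s : seq word) (F : word -> R) :
  all (fun w => size w <= n)%N s ->
  \sum_(w <- s) F w = \sum_(w <- words n) F w *+ count_mem w s.
Proof.
elim: s => [|t s IH] /=; first by rewrite big_nil big1.
move=> /andP[tn /IH sn]; rewrite big_cons sn.
rewrite [in RHS](eq_bigr (fun w => F w *+ (w == t) + F w *+ count_mem w s)).
  2: by move=> w _; rewrite mulrnDr eq_sym.
rewrite big_split /=; congr (_ + _).
rewrite (bigD1_seq t) ?words_uniq ?mem_words //= eqxx mulr1n big1 ?addr0 //.
by move=> w /negbTE ->.
Qed.

Lemma sum_tupleS k (F : word -> R) :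
  \sum_(w : k.+1.-tuple 'I_d) F (tval w) =
  \sum_(i < d) \sum_(w : k.-tuple 'I_d) F (i :: tval w).
Proof.
rewrite pair_big /=.
rewrite (reindex (fun p : 'I_d * k.-tuple 'I_d => [tuple of p.1 :: p.2])) /=.
  by [].
exists (fun t : k.+1.-tuple 'I_d => (thead t, [tuple of behead t])).
  by move=> [i w] _; congr (_, _); apply: val_inj.
by move=> t _; rewrite -tuple_eta.
Qed.

Lemma sum_tuple0 (F : word -> R) :
  \sum_(w : 0.-tuple 'I_d) F (tval w) = F [::].
Proof. by rewrite (big_pred1 [tuple]) // => w; apply/esym/eqP; exact: tuple0. Qed.

Lemma sum_tuple_words n (F : word -> R) :
  \sum_(k < n.+1) \sum_(w : k.-tuple 'I_d) F (tval w) = \sum_(w <- words n) F w.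
Proof.
elim: n F => [|n IH] F; first by rewrite big_ord1 big_seq1 sum_tuple0.
rewrite big_ord_recl sum_tuple0 big_wordsS; congr (_ + _).
rewrite (eq_bigr (fun k : 'I_n.+1 => \sum_(i < d) \sum_(w : k.-tuple 'I_d)
  F (i :: tval w))); last by move=> k _; exact: sum_tupleS.
by rewrite exchange_big; apply: eq_bigr => i _; rewrite -IH.
Qed.

Variable v : 'I_d -> tseries.
Hypothesis v0 : forall i, v i [::] = 0.

Definition subst_letter i : tseries := sadd (@letter R d i) (v i).

Lemma subst_letter0 i : subst_letter i [::] = 0.
Proof. by rewrite /subst_letter /sadd v0 addr0. Qed.

Lemma img_word_cons i w : img_word v (i :: w) = tprod (subst_letter i) (img_word v w).
Proof. by []. Qed.

Lemma img_word_small w u : (size u < size w)%N -> img_word v w u = 0.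
Proof.
elim: w u => [|i w IH] u // uw; rewrite img_word_cons.
case: u uw => [|j u] uw; first by rewrite tprod_nil subst_letter0 mul0r.
rewrite -(tprod0r (subst_letter i) (j :: u)).
apply: (agree_tprod_shift (n := size u) (subst_letter0 i)) => //.
by move=> t tn; apply: IH; apply: leq_ltn_trans tn _.
Qed.

Lemma TvE n x u : (size u <= n)%N ->
  Tv v x u = \sum_(w <- words n) x w * img_word v w u.
Proof.
move=> un; rewrite -(sum_tuple_words n (fun w => x w * img_word v w u)) /Tv.
rewrite (big_ord_widen n.+1 (fun k => \sum_(w : k.-tuple 'I_d) x w * img_word v w u)) //.
rewrite big_mkcond; apply: eq_bigr => k _; case: ltnP => // h.
by rewrite big1 // => w _; rewrite img_word_small ?mulr0 // size_tuple.
Qed.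

Lemma agree_Tv n x y : agree n x y -> agree n (Tv v x) (Tv v y).
Proof.
move=> h u un; rewrite !(TvE _ un) !big_seq; apply: eq_bigr => w.
by rewrite mem_words => /h ->.
Qed.

(** Reflects the decomposition of [x] into its constant term and, for each letter, that letter times
    the left quotient. *)
Lemma Tv_rec x u :
  Tv v x u = x [::] * @sone R d u +
             \sum_(i < d) tprod (subst_letter i) (Tv v (lquot i x)) u.
Proof.
rewrite (TvE _ (leqnSn _)) big_wordsS; congr (_ + _); apply: eq_bigr => i _.
pose S t := \sum_(w <- words (size u)) x (i :: w) * img_word v w t.
rewrite [RHS](agree_tprod (n := size u) (x' := subst_letter i) (y' := S)) //.
  rewrite (tprod_sumr _ _ (fun w t => x (i :: w) * img_word v w t)).
  by apply: eq_bigr => w _; rewrite img_word_cons -tprod_scaler.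
by move=> t tn; rewrite (TvE _ tn).
Qed.

Lemma Tv_nil x : Tv v x [::] = x [::].
Proof.
by rewrite /Tv big_ord1 (sum_tuple0 (fun w => x w * img_word v w [::])) mulr1.
Qed.

Lemma Tv_add x y : Tv v (sadd x y) = sadd (Tv v x) (Tv v y).
Proof.
apply/funext => u; rewrite /sadd !(TvE _ (leqnn _)) -big_split.
by apply: eq_bigr => w _; rewrite mulrDl.
Qed.

Lemma Tv_scale a x : Tv v (sscale a x) = sscale a (Tv v x).
Proof.
apply/funext => u; rewrite /sscale !(TvE _ (leqnn _)) mulr_sumr.
by apply: eq_bigr => w _; rewrite mulrA.
Qed.

Lemma Tv_sub x y : Tv v (ssub x y) = ssub (Tv v x) (Tv v y).
Proof.
apply/funext => u; rewrite /ssub !(TvE _ (leqnn _)) -sumrB.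
by apply: eq_bigr => w _; rewrite mulrBl.
Qed.

Lemma Tv_zero : Tv v (@szero R d) = @szero R d.
Proof.
by apply/funext => u; rewrite (TvE _ (leqnn _)) big1 // => w _; rewrite mul0r.
Qed.

Lemma Tv_one : Tv v (@sone R d) = @sone R d.
Proof.
apply/funext => u; rewrite Tv_rec mul1r big1 ?addr0 // => i _.
rewrite (_ : lquot i _ = @szero R d) // Tv_zero.
by rewrite tprod0r.
Qed.

Lemma Tv_letter i : Tv v (@letter R d i) = subst_letter i.
Proof.
apply/funext => u; rewrite Tv_rec {1}/letter /= mul0r add0r (bigD1 i) //=.
rewrite (_ : lquot i _ = @sone R d); last first.
  by apply/funext => -[|j w]; rewrite /lquot /letter eqseq_cons eqxx.
rewrite Tv_one tprod1r big1 ?addr0 // => j ji.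
rewrite (_ : lquot j _ = @szero R d).
  by rewrite Tv_zero tprod0r.
by apply/funext => w; rewrite /lquot /letter eqseq_cons (negbTE ji).
Qed.

(** As functions of the left factor, both sides obey the same first-letter recursion ([E] and [F]).
    Substituted letters have no constant term, so this recursion fixes the coefficients degree by
    degree; the left factor must vary, since it is replaced by its quotients. *)
Lemma Tv_tprod x y : Tv v (tprod x y) = tprod (Tv v x) (Tv v y).
Proof.
suff H n : forall x, agree n (Tv v (tprod x y)) (tprod (Tv v x) (Tv v y)).
  by apply: agree_all => n; apply: H.
have E z u : tprod (Tv v z) (Tv v y) u = z [::] * Tv v y u +
    \sum_(i < d) tprod (subst_letter i) (tprod (Tv v (lquot i z)) (Tv v y)) u.
  have -> : Tv v z = sadd (sscale (z [::]) (@sone R d))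
      (fun t => \sum_(i < d) tprod (subst_letter i) (Tv v (lquot i z)) t).
    by apply/funext => t; rewrite Tv_rec.
  rewrite tprod_addl tprod_scalel tprod1l; congr (_ + _).
  rewrite (tprod_suml _ (fun i => tprod (subst_letter i) (Tv v (lquot i z)))).
  by apply: eq_bigr => i _; rewrite tprodA.
have F z u : Tv v (tprod z y) u = z [::] * Tv v y u +
    \sum_(i < d) tprod (subst_letter i) (Tv v (tprod (lquot i z) y)) u.
  rewrite Tv_rec tprod_nil [Tv v y u]Tv_rec mulrDr mulrA -addrA; congr (_ + _).
  rewrite mulr_sumr -big_split; apply: eq_bigr => i _.
  by rewrite lquot_tprod Tv_add Tv_scale tprod_addr tprod_scaler.
elim: n => [|n IH] z u un; rewrite E F; congr (_ + _); apply: eq_bigr => i _.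
  by case: u un => // _; rewrite !tprod_nil subst_letter0 !mul0r.
by apply: (agree_tprod_shift (n := n)) => //; rewrite ?subst_letter0.
Qed.

(** * Compatibility of the substitution with the coproduct *)

Hypothesis vprim : forall i, primitive (v i).

Lemma primitive_subst_letter i : primitive (subst_letter i).
Proof.
move=> u w; rewrite shpair_add primitive_letter vprim /subst_letter /sadd.
ring.
Qed.

(** The image of a word is a product of primitive series; in the product of their coproducts each
    letter chooses a side, which enumerates the unshuffles of [w]. *)
Lemma shpair_img_word w u u' :
  shpair (img_word v w) u u' =
  \sum_(p <- unshuffle w) img_word v p.1 u * img_word v p.2 u'.
Proof.
elim: w u u' => [|i w IH] u u'.
  rewrite big_seq1 /=; case: u => [|j u]; first by rewrite shpair0l mul1r.
  rewrite mul0r /shpair big_seq big1 // => -[|] // /size_shl.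
  by rewrite addSn.
rewrite img_word_cons primitive_shpair_tprod; last exact: primitive_subst_letter.
rewrite /= big_cat !big_map /=; congr (_ + _).
  rewrite (_ : (fun t => _) = fun t => \sum_(p <- unshuffle w)
     (sscale (img_word v p.2 u') (img_word v p.1)) t); last first.
    by apply/funext => t; rewrite IH; apply: eq_bigr => p _; rewrite mulrC.
  rewrite tprod_sumr; apply: eq_bigr => p _.
  by rewrite tprod_scaler mulrC.
rewrite (_ : (fun t => _) = fun t => \sum_(p <- unshuffle w)
     (sscale (img_word v p.1 u) (img_word v p.2)) t); last first.
  by apply/funext => t; rewrite IH.
by rewrite tprod_sumr; apply: eq_bigr => p _; rewrite tprod_scaler.
Qed.

Lemma unshuffle_size w p : p \in unshuffle w -> (size p.1 + size p.2 = size w)%N.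
Proof.
elim: w p => [|i w IH] p /=; first by rewrite inE => /eqP ->.
rewrite mem_cat => /orP[] /mapP[q /IH <- ->] //=.
by rewrite addnS.
Qed.

(** Duality trades splittings of [w] for pairs weighted by shuffle multiplicity, over a range
    independent of [w], so that a sum over [w] can be exchanged with it. *)
Lemma sum_unshuffle n w (G : word -> word -> R) : (size w <= n)%N ->
  \sum_(p <- unshuffle w) G p.1 p.2 =
  \sum_(a <- words n) \sum_(b <- words n) G a b *+ count_mem w (shl a b).
Proof.
move=> wn.
under [RHS]eq_bigr do under eq_bigr do rewrite count_shl_unshuffle.
have : all (fun p => (size p.1 <= n) && (size p.2 <= n))%N (unshuffle w).
  apply/allP => p /unshuffle_size pw.
  by rewrite -pw in wn; rewrite !(leq_trans _ wn) // ?leq_addr ?leq_addl.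
elim: (unshuffle w) => [|[c e] s IH] /=.
  by rewrite big_nil big1 // => a _; rewrite big1.
move=> /andP[/andP[cn en] /IH sn]; rewrite big_cons sn.
under [RHS]eq_bigr do under eq_bigr do rewrite mulrnDr.
under [RHS]eq_bigr do rewrite big_split /=.
rewrite big_split /=; congr (_ + _).
rewrite (bigD1_seq c) ?words_uniq ?mem_words //=.
rewrite (bigD1_seq e) ?words_uniq ?mem_words //= eqxx mulr1n.
rewrite !big1 ?addr0 // => [a ac|b be]; first rewrite big1 // => b _.
  by rewrite xpair_eqE eq_sym (negbTE ac).
by rewrite xpair_eqE eqxx /= eq_sym (negbTE be).
Qed.

Lemma shpair_Tv x u u' :
  shpair (Tv v x) u u' =
  \sum_(a <- words (size u + size u')) \sum_(b <- words (size u + size u'))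
    shpair x a b * (img_word v a u * img_word v b u').
Proof.
set n := (size u + size u')%N.
pose S t := \sum_(w <- words n) x w * img_word v w t.
rewrite (agree_shpair (n := n) (y := S)) //; last by move=> t tn; apply: TvE.
transitivity (\sum_(w <- words n) x w * shpair (img_word v w) u u').
  by rewrite /shpair exchange_big; apply: eq_bigr => w _; rewrite mulr_sumr.
transitivity (\sum_(w <- words n) \sum_(a <- words n) \sum_(b <- words n)
   (x w *+ count_mem w (shl a b)) * (img_word v a u * img_word v b u')).
  rewrite !big_seq; apply: eq_bigr => w; rewrite mem_words => wn.
  rewrite shpair_img_word (sum_unshuffle (fun a b : word => img_word v a u * img_word v b u') wn).
  rewrite mulr_sumr; apply: eq_bigr => a _; rewrite mulr_sumr.
  by apply: eq_bigr => b _; rewrite mulrnAl mulrnAr.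
rewrite exchange_big; apply: eq_bigr => a _.
rewrite exchange_big; apply: eq_bigr => b _ /=.
rewrite -mulr_suml.
(* Pairs with [a] longer than [u] or [b] longer than [u'] contribute nothing; for the others every
   shuffle fits the length bound that [sum_words_count] demands. *)
have [ua|ua] := ltnP (size u) (size a).
  by rewrite (img_word_small ua) !(mul0r, mulr0).
have [ub|ub] := ltnP (size u') (size b).
  by rewrite (img_word_small ub) !(mul0r, mulr0).
rewrite -sum_words_count //; apply/allP => w /size_shl ->.
exact: leq_add.
Qed.

Lemma shuffle_rel_Tv x : shuffle_rel x -> shuffle_rel (Tv v x).
Proof.
move=> gx u u'; rewrite pair_shE shpair_Tv.
rewrite (TvE x (leq_addr (size u') (size u))) (TvE x (leq_addl (size u) (size u'))).
rewrite big_distrlr /=; apply: eq_bigr => a _; apply: eq_bigr => b _.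
by rewrite -pair_shE gx mulrACA.
Qed.

End Substitution.

(** * Lie polynomials and Lie series *)

Section LieGrading.
Variables (R : realType) (d : nat).
Local Notation word := (word d).
Local Notation tseries := (tseries R d).
Implicit Types (x y z : tseries) (u w : word) (i j : 'I_d) (a b : R).

Lemma is_lie_poly_sum (I : Type) (r : seq I) (F : I -> tseries) :
  (forall k, is_lie_poly (F k)) -> is_lie_poly (fun w => \sum_(k <- r) F k w).
Proof.
move=> lF; elim: r => [|k r IH].
  rewrite (_ : (fun w => _) = @szero R d); first exact: lie_zero.
  by apply/funext => w; rewrite big_nil.
rewrite (_ : (fun w => _) = sadd (F k) (fun w => \sum_(k <- r) F k w)).
  exact: lie_add.
by apply/funext => w; rewrite big_cons.
Qed.

Lemma homog_tprod n x y w :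
  homog n (tprod x y) w =
  \sum_(k < n.+1) tprod (homog k x) (homog (n - k) y) w.
Proof.
rewrite exchange_big /= /homog; case: eqP => wn.
  rewrite /tprod; rewrite wn; apply: eq_bigr => l _.
  have lw : (l <= size w)%N by rewrite wn -ltnS.
  rewrite (bigD1 l) //= size_take_min (minn_idPl lw) size_drop wn !eqxx.
  by rewrite big1 ?addr0 // => k kl; rewrite eq_sym ifN // mul0r.
rewrite big1 // => l _; have lw : (l <= size w)%N by rewrite -ltnS.
rewrite big1 // => k _; rewrite size_take_min (minn_idPl lw) size_drop.
case: eqP => [lk|]; last by rewrite mul0r.
case: eqP => [e|]; last by rewrite mulr0.
have kn : (k <= n)%N by rewrite -ltnS.
by case: wn; rewrite -(subnK lw) e lk subnK.
Qed.

Lemma homog_lie_poly n x : is_lie_poly x -> is_lie_poly (homog n x).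
Proof.
move=> lx; elim: lx n => {x} [|i|x y _ lx _ ly|a x _ lx|x y _ lx _ ly] n.
- rewrite (_ : homog n _ = @szero R d); first exact: lie_zero.
  by apply/funext => w; rewrite /homog; case: ifP.
- case: (n =P 1%N) => [->|n1].
    rewrite (_ : homog 1 _ = letter R i); first exact: lie_gen.
    apply/funext => w; rewrite /homog; case: eqP => //.
    by rewrite /letter; case: eqP => // -> [].
  rewrite (_ : homog n _ = @szero R d); first exact: lie_zero.
  apply/funext => w; rewrite /homog; case: eqP => // wn.
  rewrite /letter; case: eqP => // wi; case: n1; by rewrite -wn wi.
- rewrite (_ : homog n _ = sadd (homog n x) (homog n y)); first exact: lie_add.
  by apply/funext => w; rewrite /homog /sadd; case: ifP; rewrite ?addr0.
- rewrite (_ : homog n _ = sscale a (homog n x)); first exact: lie_scale.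
  by apply/funext => w; rewrite /homog /sscale; case: ifP; rewrite ?mulr0.
- rewrite (_ : homog n _ = fun w => \sum_(k < n.+1)
    ssub (tprod (homog k x) (homog (n - k) y)) (tprod (homog (n - k) y) (homog k x)) w).
    by apply: is_lie_poly_sum => k; apply: lie_bracket.
  apply/funext => w; rewrite sumrB -homog_tprod.
  (* Reversing the second sum recovers the product in the opposite order, so the homogeneous part of
     a bracket is a sum of brackets. *)
  rewrite [X in _ - X](reindex_inj rev_ord_inj) /=.
  rewrite (eq_bigr (fun k : 'I_n.+1 => tprod (homog k y) (homog (n - k) x) w)).
    by rewrite -homog_tprod /homog /ssub; case: ifP; rewrite ?subr0.
  by move=> k _; rewrite subSS subKn // -ltnS.
Qed.

Lemma tproj_lie_poly n x : is_lie_poly x -> is_lie_poly (tproj n x).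
Proof.
move=> lx; rewrite (_ : tproj n x = fun w => \sum_(k < n.+1) homog k x w).
  by apply: is_lie_poly_sum => k; apply: homog_lie_poly.
apply/funext => w; rewrite /tproj /homog; case: leqP => wn.
  by rewrite (bigD1 (Ordinal (wn : (size w < n.+1)%N))) //= eqxx big1 ?addr0 // => k;
    rewrite eq_sym -val_eqE /= => /negbTE ->.
by rewrite big1 // => k _; rewrite gtn_eqF // (leq_ltn_trans _ wn) // -ltnS.
Qed.

(** Primitivity tested at [u] and [w] involves only the homogeneous component of degree
    [size u + size w], which is a Lie polynomial. *)
Lemma primitive_lie_series x : is_lie_series x -> primitive x.
Proof.
move=> lx u w; set n := (size u + size w)%N.
have H t : size t = n -> x t = homog n x t by move=> tn; rewrite /homog tn eqxx.
rewrite (_ : shpair x u w = shpair (homog n x) u w); last first.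
  rewrite /shpair !big_seq; apply: eq_bigr => t /size_shl; exact: H.
rewrite (primitive_lie_poly (lx n)).
case: u w @n H => [|i u] [|j w] n H /=; rewrite ?mulr0 ?mul0r // ?addr0 ?add0r.
- by rewrite -H.
- by rewrite -H // /n addn0.
Qed.

Variable v : 'I_d -> tseries.
Hypothesis v0 : forall i, v i [::] = 0.

Lemma Tv_lie_poly x : (forall i, is_lie_poly (v i)) ->
  is_lie_poly x -> is_lie_poly (Tv v x).
Proof.
move=> lv; elim=> {x} [|i|x y _ lx _ ly|a x _ lx|x y _ lx _ ly].
- by rewrite Tv_zero //; apply: lie_zero.
- by rewrite Tv_letter //; apply: lie_add => //; apply: lie_gen.
- by rewrite Tv_add //; apply: lie_add.
- by rewrite Tv_scale //; apply: lie_scale.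
- by rewrite Tv_sub // !Tv_tprod //; apply: lie_bracket.
Qed.

Lemma img_word_large K w u :
  (forall i t, (K < size t)%N -> subst_letter v i t = 0) ->
  (size w * K < size u)%N -> img_word v w u = 0.
Proof.
move=> hK; elim: w u => [|i w IH] u; first by case: u.
rewrite img_word_cons (mulSn (size w)) => wu; rewrite /tprod big1 // => k _.
have ku : (k <= size u)%N by rewrite -ltnS.
have [kK|kK] := ltnP K k.
  by rewrite hK ?mul0r // size_take_min (minn_idPl ku).
rewrite IH ?mulr0 // size_drop ltn_subRL.
by apply: leq_ltn_trans wu; rewrite leq_add2r.
Qed.

(** The factor is [maxn 1 N'] because the letter in [e_i + v_i] has degree one even when all [v i]
    vanish and [N'] is 0. *)
Lemma Tv_in_LieN N N' D : (forall i, is_lie_poly (v i)) ->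
  (forall i, in_LieN N' (v i)) -> in_LieN N D ->
  in_LieN (N * maxn 1 N') (Tv v D).
Proof.
move=> lv lvN [p [lp Dp]]; exists (Tv v D); split.
  by apply: Tv_lie_poly => //; rewrite Dp; apply: tproj_lie_poly.
apply/funext => u; rewrite [RHS]/tproj; case: leqP => // uN.
rewrite (TvE v0 _ (leqnn _)) big1 // => w _.
have [wN|wN] := leqP (size w) N; last first.
  by rewrite Dp /tproj leqNgt wN mul0r.
rewrite (img_word_large (K := maxn 1 N')) ?mulr0 //; last first.
  by apply: leq_ltn_trans uN; rewrite leq_mul2r wN orbT.
move=> i t; rewrite gtn_max => /andP[t1 tN].
have [q [_ vq]] := lvN i.
rewrite /subst_letter /sadd vq /tproj leqNgt tN /= addr0 /letter.
by case: eqP t1 => // ->.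
Qed.

End LieGrading.

(** * Group-like series: constant term and truncation *)

Section GroupLike.
Variables (R : realType) (d : nat).
Implicit Types (x : tseries R d) (u w : word d).

Lemma shuffle_rel_nil x : shuffle_rel x -> x [::] = 0 \/ x [::] = 1.
Proof.
move=> /(_ [::] [::]); rewrite pair_shE shpair0l => /esym/eqP.
rewrite -{3}[x [::]]mulr1 -subr_eq0 -mulrBr mulf_eq0 subr_eq0 => /orP[] /eqP;
  by [left|right].
Qed.

Lemma shuffle_rel_neq0 x : shuffle_rel x -> x <> @szero R d -> x [::] = 1.
Proof.
move=> gx nx; have [x0|//] := shuffle_rel_nil gx.
case: nx; apply/funext => w.
by have := gx [::] w; rewrite pair_shE shpair0l x0 mul0r.
Qed.

Lemma shuffle_relN_tproj n x : shuffle_rel x -> shuffle_relN n (tproj n x).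
Proof.
move=> gx u w uwn; rewrite pair_shE (agree_shpair uwn (@agree_tprojl _ _ n x)).
by rewrite -pair_shE gx /tproj !(leq_trans _ uwn) ?leq_addr ?leq_addl.
Qed.

End GroupLike.

Import numFieldNormedType.Exports.

(** * Calculus on a closed interval *)

Section OneSidedCalculus.
Local Open Scope classical_set_scope.
Variables (R : realType) (T : R).
Implicit Types (f g : R -> R) (s t l : R).

Lemma deriv_within_eq f g s l : (forall t, 0 <= t <= T -> f t = g t) ->
  0 <= s <= T -> deriv_within T f s l -> deriv_within T g s l.
Proof.
move=> fg sT; apply: cvg_trans; apply: near_eq_cvg.
by rewrite near_withinE; apply: nearW => t [_ tT]; rewrite !fg.
Qed.

Lemma deriv_within_cst (c : R) s : deriv_within T (fun=> c) s 0.
Proof.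
rewrite /deriv_within (_ : (fun t => _) = fun=> 0); first exact: cvg_cst.
by apply/funext => t; rewrite subrr mul0r.
Qed.

Lemma deriv_withinD f g s l k : deriv_within T f s l -> deriv_within T g s k ->
  deriv_within T (fun t => f t + g t) s (l + k).
Proof.
move=> df dg; rewrite /deriv_within.
rewrite (_ : (fun t => _) = (fun t => (f t - f s) / (t - s) + (g t - g s) / (t - s))).
  exact: cvgD.
by apply/funext => t; rewrite -mulrDl opprD addrACA.
Qed.

Lemma deriv_withinZ (c : R) f s l : deriv_within T f s l ->
  deriv_within T (fun t => c * f t) s (c * l).
Proof.
move=> df; rewrite /deriv_within.
rewrite (_ : (fun t => _) = (fun t => c * ((f t - f s) / (t - s)))).
  exact: cvgMl_tmp.
by apply/funext => t; rewrite mulrA mulrBr.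
Qed.

Lemma deriv_withinZr (c : R) f s l : deriv_within T f s l ->
  deriv_within T (fun t => f t * c) s (l * c).
Proof.
move=> /(deriv_withinZ (c := c)); rewrite mulrC (_ : (fun t => _) = fun t => f t * c) //.
by apply/funext => t; rewrite mulrC.
Qed.

Lemma deriv_within_sum (I : Type) (r : seq I) (F : I -> R -> R) (L : I -> R) s :
  (forall i, deriv_within T (F i) s (L i)) ->
  deriv_within T (fun t => \sum_(i <- r) F i t) s (\sum_(i <- r) L i).
Proof.
move=> h; elim: r => [|i r IH].
  rewrite big_nil (_ : (fun t => _) = fun=> 0); first exact: deriv_within_cst.
  by apply/funext => t; rewrite big_nil.
rewrite big_cons (_ : (fun t => _) = fun t => F i t + \sum_(i <- r) F i t).
  exact: deriv_withinD.
by apply/funext => t; rewrite big_cons.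
Qed.

(** The limit runs over the punctured interval, so points must accumulate at [s]: from the right
    when [s < T], from the left when [s = T]. *)
Lemma deriv_within_unique f s l k : 0 < T -> 0 <= s <= T ->
  deriv_within T f s l -> deriv_within T f s k -> l = k.
Proof.
move=> T0 /andP[s0 sT] dl dk.
suff cl : closure [set t | t != s /\ 0 <= t <= T] s.
  have pF := within_nbhs_proper cl.
  exact: (cvg_unique _ dl dk).
move=> B /nbhs_ballP[e /= e0 eB].
have [sT'|Ts] := ltP s T.
  pose h := Num.min (e / 2) (T - s).
  have h0 : 0 < h by rewrite lt_min divr_gt0 // subr_gt0.
  have hT : h <= T - s by rewrite ge_min lexx orbT.
  have he : h < e by rewrite gt_min ltr_pdivrMr // ltr_pMr // ltr1n.
  exists (s + h); split; first by split; lra.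
  by apply: eB; rewrite /ball /= opprD addNKr normrN gtr0_norm.
have {sT Ts} sT : s = T by apply/eqP; rewrite eq_le sT.
pose h := Num.min (e / 2) T.
have h0 : 0 < h by rewrite lt_min divr_gt0.
have hT : h <= T by rewrite ge_min lexx orbT.
have he : h < e by rewrite gt_min ltr_pdivrMr // ltr_pMr // ltr1n.
exists (s - h); split; first by split; lra.
by apply: eB; rewrite /ball /= subKr gtr0_norm.
Qed.

Lemma deriv_within_continuous f s l : deriv_within T f s l ->
  f @ within [set t | 0 <= t <= T] (nbhs s) --> f s.
Proof.
move=> /cvgrPdist_lt /(_ 1 ltr01) /=; rewrite near_withinE => dq.
apply/cvgrPdist_lt => e e0; rewrite near_withinE.
have c0 : 0 < `|l| + 1 by rewrite ltr_wpDl.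
near=> t => tT.
have [->|ts] := eqVneq t s; first by rewrite subrr normr0.
have q1 : `|l - (f t - f s) / (t - s)| < 1.
  by have : t != s /\ 0 <= t <= T by []; near: t.
have ts0 : t - s != 0 by rewrite subr_eq0.
have -> : f s - f t = - ((f t - f s) / (t - s)) * (t - s).
  by rewrite mulNr divfK // opprB.
rewrite normrM normrN.
have qc : `|(f t - f s) / (t - s)| <= `|l| + 1.
  rewrite -[X in `|X|](subKr l).
  by apply: le_trans (ler_normB _ _) _; rewrite lerD2l ltW.
apply: le_lt_trans (ler_wpM2r (normr_ge0 _) qc) _.
rewrite mulrC -ltr_pdivlMr // distrC.
by near: t; apply: (@cvgr_dist_lt _ _ _ (nbhs s) _ id s) => //; rewrite divr_gt0.
Unshelve. all: by end_near. Qed.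

(** Only interior points give a two-sided derivative; the mean value theorem asks no more, with
    continuity at the endpoints. *)
Lemma deriv_within_is_derive f s l : 0 < s < T -> deriv_within T f s l ->
  is_derive s 1 f l.
Proof.
move=> /andP[s0 sT] df.
have H : (fun h => h^-1 *: ((f \o shift s) (h *: (1 : R)) - f s)) @ 0^' --> l.
  apply/cvgrPdist_lt => e e0.
  have /cvgrPdist_lt /(_ e e0) := df; rewrite near_withinE => /nbhs_ballP[r /= r0 dr].
  near=> h; have h0 : h != 0 by near: h; exact: nbhs_dnbhs_neq.
  have hr : `|h| < r by near: h; apply: dnbhs0_lt.
  have hs : `|h| < s by near: h; apply: dnbhs0_lt.
  have hT : `|h| < T - s by near: h; apply: dnbhs0_lt; rewrite subr_gt0.
  have /= := dr (h + s); rewrite /ball /= opprD addrCA subrr addr0 normrN addrK.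
  rewrite /GRing.scale /= mulr1 [h^-1 * _]mulrC; apply=> //; split.
    by rewrite -subr_eq0 addrK.
  move: hs hT; rewrite !ltr_norml => /andP[h1 _] /andP[_ h2].
  by apply/andP; split; lra.
by apply: DeriveDef; [exact: cvgP H|exact: cvg_lim H].
Unshelve. all: by end_near. Qed.

Lemma within_itv_continuous f a b : 0 <= a -> b <= T ->
  (forall s, 0 <= s <= T -> exists l, deriv_within T f s l) ->
  {within `[a, b], continuous f}.
Proof.
move=> a0 bT df; apply/subspace_continuousP => s /=; rewrite in_itv /= => /andP[sa sb].
have [l /deriv_within_continuous] := df s (introT andP (conj (le_trans a0 sa) (le_trans sb bT))).
apply: cvg_trans; apply: cvg_app; apply: within_subset => t /=.
by rewrite in_itv /= => /andP[ta tb]; rewrite (le_trans a0 ta) (le_trans tb bT).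
Qed.

Lemma deriv_within0_cst f : (forall s, 0 <= s <= T -> deriv_within T f s 0) ->
  forall t, 0 <= t <= T -> f t = f 0.
Proof.
move=> df t /andP[]; rewrite le_eqVlt => /predU1P[<- //|t0 tT].
have [||c _ /eqP] := @MVT R f (fun=> 0) 0 t t0.
- move=> s; rewrite in_itv /= => /andP[s0 st]; apply: deriv_within_is_derive.
    by rewrite s0 (lt_le_trans st).
  by apply: df; rewrite ltW // ltW // (lt_le_trans st).
- by apply: within_itv_continuous => // s sT; exists 0; apply: df.
- by rewrite mul0r subr_eq0 => /eqP.
Qed.

Lemma smooth_on_deriv f s : smooth_on T f -> 0 <= s <= T ->
  exists l, deriv_within T f s l.
Proof.
move=> [F [F0 dF]] sT; exists (F 1%N s).
exact: deriv_within_eq F0 sT (dF 0%N s sT).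
Qed.

(** A switch between 0 and 1 would pass through one half. This propagates the constant term of a
    path from a time at which the path is non-zero. *)
Lemma smooth_on_01_cst f : smooth_on T f ->
  (forall t, 0 <= t <= T -> f t = 0 \/ f t = 1) ->
  forall s t, 0 <= s <= T -> 0 <= t <= T -> f s = f t.
Proof.
move=> sf f01.
suff H s t : 0 <= s <= T -> 0 <= t <= T -> s <= t -> f s = f t.
  by move=> s t sT tT; have [st|/ltW ts] := leP s t; [|symmetry]; apply: H.
move=> sT tT st; have [s0 _] := andP sT; have [_ tT'] := andP tT.
have cf : {within `[s, t], continuous f}.
  by apply: within_itv_continuous => // r rT; apply: smooth_on_deriv.
have h : Num.min (f s) (f t) <= 2^-1 <= Num.max (f s) (f t) -> False.
  move=> /(IVT st cf) [c]; rewrite in_itv /= => /andP[sc ct] fc.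
  by case: (f01 c); rewrite ?(le_trans s0 sc) ?(le_trans ct tT') // fc; lra.
case: (f01 s sT) (f01 t tT) h => -> [] -> // h; exfalso; apply: h.
  by rewrite min_l ?max_r ?ler01 // invr_ge0 ler0n invf_le1 // ler1n.
by rewrite min_r ?max_l ?ler01 // invr_ge0 ler0n invf_le1 // ler1n.
Qed.

Lemma smooth_on_eq f g : (forall t, 0 <= t <= T -> f t = g t) ->
  smooth_on T f -> smooth_on T g.
Proof. by move=> fg [F [F0 dF]]; exists F; split=> // t tT; rewrite F0 // fg. Qed.

Lemma smooth_on_cst0 : smooth_on T (fun=> 0).
Proof. by exists (fun _ _ => 0); split=> // n s _; apply: deriv_within_cst. Qed.

Lemma smooth_onD f g : smooth_on T f -> smooth_on T g ->
  smooth_on T (fun t => f t + g t).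
Proof.
move=> [F [F0 dF]] [G [G0 dG]]; exists (fun n t => F n t + G n t).
split=> [t tT|n s sT]; first by rewrite F0 ?G0.
by apply: deriv_withinD; [apply: dF|apply: dG].
Qed.

Lemma smooth_onZ (c : R) f : smooth_on T f -> smooth_on T (fun t => c * f t).
Proof.
move=> [F [F0 dF]]; exists (fun n t => c * F n t).
split=> [t tT|n s sT]; first by rewrite F0.
by apply: deriv_withinZ; apply: dF.
Qed.

Lemma smooth_on_sum (I : Type) (r : seq I) (F : I -> R -> R) :
  (forall i, smooth_on T (F i)) -> smooth_on T (fun t => \sum_(i <- r) F i t).
Proof.
move=> h; elim: r => [|i r IH].
  by apply: smooth_on_eq smooth_on_cst0 => t _; rewrite big_nil.
by apply: smooth_on_eq (smooth_onD (h i) IH) => t _; rewrite big_cons.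
Qed.

End OneSidedCalculus.

(** * Paths, models and the linear equation *)

Section Paths.
Variables (R : realType) (d : nat) (T : R).
Hypothesis T_gt0 : 0 < T.
Local Notation word := (word d).
Local Notation tseries := (tseries R d).
Implicit Types (X Z W : R -> tseries) (m : R -> R -> tseries) (D x : tseries).
Implicit Types (s t r : R) (w : word).

Lemma zero_in_itv : 0 <= (0 : R) <= T.
Proof. by rewrite lexx ltW. Qed.

Lemma deriv_within_tprod x X s D w :
  (forall w, deriv_within T (fun r => X r w) s (D w)) ->
  deriv_within T (fun r => tprod x (X r) w) s (tprod x D w).
Proof. by move=> dX; apply: deriv_within_sum => k; apply: deriv_withinZ. Qed.

Lemma deriv_within_Tv v X s D w :
  (forall w, deriv_within T (fun r => X r w) s (D w)) ->
  deriv_within T (fun r => Tv v (X r) w) s (Tv v D w).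
Proof.
move=> dX; apply: deriv_within_sum => k; apply: deriv_within_sum => u.
exact: deriv_withinZr.
Qed.

Lemma smooth_on_tprod x X w : (forall w, smooth_on T (fun r => X r w)) ->
  smooth_on T (fun r => tprod x (X r) w).
Proof. by move=> sX; apply: smooth_on_sum => k; apply: smooth_onZ. Qed.

Lemma smooth_on_Tv v X w : (forall w, smooth_on T (fun r => X r w)) ->
  smooth_on T (fun r => Tv v (X r) w).
Proof.
move=> sX; apply: smooth_on_sum => k; apply: smooth_on_sum => u.
by apply: smooth_on_eq (smooth_onZ (img_word v u w) (sX u)) => t _; rewrite mulrC.
Qed.

(* The coefficient of w only involves strictly shorter words because the
   driving series has no constant term, so the system is triangular. *)
Lemma linear_ode_eq0 n (E : R -> tseries) :
  agree n (E 0) (@szero R d) ->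
  (forall t, 0 <= t <= T -> exists2 A : tseries, A [::] = 0 &
     forall w, (size w <= n)%N ->
       deriv_within T (fun r => E r w) t (tprod (E t) A w)) ->
  forall t, 0 <= t <= T -> agree n (E t) (@szero R d).
Proof.
move=> E0 dE t tT w; move: {2}(size w) (leqnn (size w)) => k.
elim: k w t tT => [|k IH] w t tT wk wn; rewrite -(E0 w wn).
  apply: (@deriv_within0_cst _ T (fun r => E r w) _ t tT) => s sT; have [A A0 /(_ w wn)] := dE s sT.
  by move: wk; rewrite leqn0 size_eq0 => /eqP ->; rewrite tprod_nil A0 mulr0.
apply: (@deriv_within0_cst _ T (fun r => E r w) _ t tT) => s sT; have [A A0 /(_ w wn)] := dE s sT.
rewrite (_ : tprod _ _ _ = 0) // /tprod big1 // => l _.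
have := ltn_ord l; rewrite ltnS leq_eqVlt => /predU1P[->|lw].
  by rewrite drop_size A0 mulr0.
have sl : (size (take l w) < size w)%N by rewrite size_take lw.
rewrite (_ : E s _ = 0) ?mul0r //; apply: IH => //.
  by rewrite -ltnS (leq_trans sl).
by rewrite (leq_trans (ltnW sl)).
Qed.

Lemma diag_deriv_nil m t D : 0 <= t <= T ->
  (forall r, 0 <= r <= T -> m t r [::] = 1) -> diag_deriv T m t D -> D [::] = 0.
Proof.
move=> tT m1 /(_ [::]) dD; apply: (deriv_within_unique T_gt0 tT dD).
by apply: deriv_within_eq (deriv_within_cst T 1 t) => // r rT; rewrite m1.
Qed.

Lemma diag_deriv_eq m m' t D : 0 <= t <= T ->
  (forall r, 0 <= r <= T -> m t r = m' t r) ->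
  diag_deriv T m t D -> diag_deriv T m' t D.
Proof.
by move=> tT mm dD w; apply: deriv_within_eq (dD w) => // r rT; rewrite mm.
Qed.

Lemma diag_deriv_unique m t D D' : 0 <= t <= T ->
  diag_deriv T m t D -> diag_deriv T m t D' -> D = D'.
Proof.
by move=> tT dD dD'; apply/funext => w; apply: deriv_within_unique (dD w) (dD' w).
Qed.

Lemma sgrp_nil X t : is_sgrp T X -> 0 <= t <= T -> X t [::] = 1.
Proof.
move=> [[s [sT nX]] [gX sX]] tT; rewrite -(shuffle_rel_neq0 (gX s sT) nX).
apply: (smooth_on_01_cst (sX [::])) => // r rT.
exact: shuffle_rel_nil (gX r rT).
Qed.

Lemma sinv_nil x : x [::] = 1 -> sinv x [::] = 1.
Proof.
move=> x1; have /(congr1 (fun z => z [::])) := sinvl x1.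
by rewrite tprod_nil x1 mulr1.
Qed.

Lemma pmodel_nil X s t : is_sgrp T X -> 0 <= s <= T -> 0 <= t <= T ->
  pmodel X s t [::] = 1.
Proof.
move=> gX sT tT; rewrite /pmodel tprod_nil sinv_nil ?(sgrp_nil gX) //.
by rewrite mulr1.
Qed.

Lemma sgrp_diag_deriv X t : is_sgrp T X -> 0 <= t <= T ->
  exists D, diag_deriv T (pmodel X) t D.
Proof.
move=> [_ [_ sX]] tT.
have /choice[D dD] w := smooth_on_deriv (smooth_on_tprod (sinv (X t)) w sX) tT.
by exists D.
Qed.

Variable v : 'I_d -> tseries.
Hypothesis vprim : forall i, primitive (v i).
Let v0 i : v i [::] = 0 := primitive0 (vprim i).

Lemma Tv_path_deriv X t D : is_sgrp T X -> 0 <= t <= T ->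
  diag_deriv T (pmodel X) t D ->
  forall w, deriv_within T (fun r => Tv v (X r) w) t (tprod (Tv v (X t)) (Tv v D) w).
Proof.
move=> gX tT dD w.
(* With [t] fixed the left factor does not depend on [r], so linearity suffices and no Leibniz rule
   enters. *)
rewrite (_ : (fun r => _) = fun r => tprod (Tv v (X t)) (Tv v (pmodel X t r)) w).
  by apply: deriv_within_tprod => u; apply: deriv_within_Tv.
apply/funext => r; rewrite -Tv_tprod // /pmodel tprodA sinvr ?tprod1l //.
exact: sgrp_nil gX tT.
Qed.

Lemma solves_Tv X : is_sgrp T X ->
  solves T v (pmodel X) (Tv v (X 0)) (fun t => Tv v (X t)).
Proof.
move=> gX; split=> // t tT; have [D dD] := sgrp_diag_deriv gX tT.
by exists D; split=> //; apply: Tv_path_deriv.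
Qed.

Lemma solves_unique X Z : is_sgrp T X ->
  solves T v (pmodel X) (Tv v (X 0)) Z ->
  forall t, 0 <= t <= T -> Z t = Tv v (X t).
Proof.
move=> gX [Z0 dZ] t tT; apply: agree_all => n w wn; apply/eqP.
rewrite -subr_eq0; apply/eqP; move: t tT w wn.
apply: (@linear_ode_eq0 n (fun r => ssub (Z r) (Tv v (X r)))).
  by move=> w _; rewrite /ssub Z0 subrr.
(* The diagonal derivative witnessed by [Z] drives [Tv v (X r)] as well, so the difference solves
   the same linear equation. *)
move=> t tT; have [D [dD dZt]] := dZ t tT; exists (Tv v D).
  rewrite Tv_nil; apply: diag_deriv_nil dD => // r rT; exact: pmodel_nil.
move=> w _; rewrite tprod_subl.
have := deriv_withinZ (c := -1) (Tv_path_deriv (w := w) gX tT dD).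
rewrite mulN1r => /(deriv_withinD (dZt w)); apply: deriv_within_eq => // r _.
by rewrite mulN1r.
Qed.

Lemma sgrp_Tv X : is_sgrp T X -> is_sgrp T (fun t => Tv v (X t)).
Proof.
move=> gX; have [_ [hX sX]] := gX; split; last split.
- exists 0; split; first exact: zero_in_itv.
  move/(congr1 (fun z => z [::])); rewrite Tv_nil (sgrp_nil gX zero_in_itv).
  by apply/eqP; rewrite oner_neq0.
- by move=> t tT; apply: shuffle_rel_Tv => //; apply: hX.
- by move=> w; apply: smooth_on_Tv.
Qed.

Lemma sgrp_eq X Z : (forall t, 0 <= t <= T -> X t = Z t) ->
  is_sgrp T X -> is_sgrp T Z.
Proof.
move=> XZ [[t [tT nX]] [gX sX]]; split; last split.
- by exists t; rewrite -XZ.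
- by move=> s sT; rewrite -XZ //; apply: gX.
- by move=> w; apply: smooth_on_eq (sX w) => s sT; rewrite XZ.
Qed.

Lemma pmodel_Tv X s t : is_sgrp T X -> 0 <= s <= T ->
  pmodel (fun r => Tv v (X r)) s t = Tv v (pmodel X s t).
Proof.
move=> gX sT; rewrite /pmodel Tv_tprod //; congr tprod.
have X1 := sgrp_nil gX sT; apply: sinv_eq; first by rewrite Tv_nil.
by rewrite -Tv_tprod // sinvl // Tv_one.
Qed.

(** * Signature models *)

Section Models.
Variable X : R -> R -> tseries.
Hypothesis gX : is_sgrm T X.

(** Smoothness concerns the second time only, so Chen's relation replaces continuity: if a product
    of values 0 or 1 equals 1, both factors are 1. This leads from the pair [a], [b] to [a], [t] and
    then to [s], [t]. *)
Lemma sgrm_nil s t : 0 <= s <= T -> 0 <= t <= T -> X s t [::] = 1.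
Proof.
have [[a [b [aT [bT nX]]]] [hX [mX _]]] := gX.
have X01 p q (pT : 0 <= p <= T) (qT : 0 <= q <= T) := shuffle_rel_nil (hX p q pT qT).
have E p r q (pT : 0 <= p <= T) (rT : 0 <= r <= T) (qT : 0 <= q <= T) :
    X p q [::] = 1 -> X p r [::] = 1 /\ X r q [::] = 1.
  rewrite -(mX p r q) // tprod_nil.
  case: (X01 p r pT rT) => ->; case: (X01 r q rT qT) => ->; rewrite ?mul0r ?mulr0 //;
  by move/eqP; rewrite eq_sym oner_eq0.
move=> sT tT; have Xab := shuffle_rel_neq0 (hX a b aT bT) nX.
have [Xat _] := E a t b aT tT bT Xab.
by have [_] := E a s t aT sT tT Xat.
Qed.

(** Chen's relation makes the diagonal value idempotent, and an invertible idempotent is the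
    unit. *)
Lemma sgrm_diag s : 0 <= s <= T -> X s s = @sone R d.
Proof.
move=> sT; have [_ [_ [mX _]]] := gX.
rewrite -[LHS]tprod1l -(sinvl (sgrm_nil sT sT)) -tprodA mX //.
Qed.

Lemma sgrm_sgrp : is_sgrp T (X 0).
Proof.
have z := zero_in_itv; have [_ [hX [_ sX]]] := gX; split; last split.
- exists 0; split=> //; move/(congr1 (fun z => z [::])); rewrite sgrm_nil //.
  by apply/eqP; rewrite oner_neq0.
- by move=> t tT; apply: hX.
- by move=> w; apply: sX.
Qed.

Lemma pmodel_sgrm s t : 0 <= s <= T -> 0 <= t <= T -> pmodel (X 0) s t = X s t.
Proof.
move=> sT tT; have z := zero_in_itv; have [_ [_ [mX _]]] := gX.
by rewrite /pmodel -(mX 0 s t) // tprodA sinvl ?sgrm_nil // tprod1l.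
Qed.

Lemma sgrm_Tv : is_sgrm T (fun s t => Tv v (X s t)).
Proof.
have [[s [t [sT [tT nX]]]] [hX [mX sX]]] := gX; split; last split; last split.
- exists s, t; do 2!split=> //; move/(congr1 (fun z => z [::])).
  by rewrite Tv_nil sgrm_nil //; apply/eqP; rewrite oner_neq0.
- by move=> p q pT qT; apply: shuffle_rel_Tv => //; apply: hX.
- by move=> p r q pT rT qT; rewrite -Tv_tprod // mX.
- by move=> p w pT; apply: smooth_on_Tv => u; apply: sX.
Qed.

Lemma sgrm_tproj n : is_Nsgrm T n (fun s t => tproj n (X s t)).
Proof.
have [[s [t [sT [tT nX]]]] [hX [mX sX]]] := gX.
split; last split; last split; last split.
- exists s, t; do 2!split=> //; move/(congr1 (fun z => z [::])).
  by rewrite /tproj /= sgrm_nil //; apply/eqP; rewrite oner_neq0.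
- by move=> p q _ _; rewrite /inTN tproj_id.
- by move=> p q pT qT; apply: shuffle_relN_tproj; apply: hX.
- move=> p r q pT rT qT; rewrite -(mX p r q) //; apply/agree_tproj.
  by apply: agree_tprod; apply: agree_tprojl.
- move=> p w pT; rewrite /tproj; case: (size w <= n)%N; first exact: sX.
  exact: smooth_on_cst0.
Qed.

Lemma solves_sgrm Z : solves T v (pmodel (X 0)) (Tv v (X 0 0)) Z ->
  forall s t, 0 <= s <= T -> 0 <= t <= T -> pmodel Z s t = Tv v (X s t).
Proof.
move=> /(solves_unique sgrm_sgrp) ZE s t sT tT.
rewrite -pmodel_sgrm // -pmodel_Tv //; last exact: sgrm_sgrp.
by rewrite /pmodel !ZE.
Qed.

Lemma pmodel_solves_sgrm Z : solves T v (pmodel (X 0)) (Tv v (X 0 0)) Z ->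
  is_sgrm T (pmodel Z).
Proof.
move=> /solves_sgrm ZE.
have [[s [t [sT [tT nX]]]] [hX [mX sX]]] := sgrm_Tv.
split; last split; last split.
- by exists s, t; rewrite ZE.
- by move=> p q pT qT; rewrite ZE //; apply: hX.
- by move=> p r q pT rT qT; rewrite !ZE //; apply: mX.
- by move=> p w pT; apply: smooth_on_eq (sX p w pT) => q qT; rewrite ZE.
Qed.

End Models.

(** * Minimal extensions and the truncated equation *)

Section MinimalExtension.
Variables (X Y : R -> R -> tseries) (N N' : nat).
Hypothesis vlie : forall i, is_lie_poly (v i).
Hypothesis gY : is_Nsgrm T N Y.
Hypothesis XY : is_MinExt T N Y X.
Let gX : is_sgrm T X := proj1 XY.

(** Up to length [N] the two models agree; beyond it [Y] vanishes, and by minimality so does [D].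
    The truncated model thus already knows the full diagonal derivative. *)
Lemma MinExt_diag_deriv s D : 0 <= s <= T ->
  diag_deriv T X s D -> in_LieN N D -> diag_deriv T Y s D.
Proof.
move=> sT dD [p [_ Dp]] w; have [_ [YN _]] := gY; have [_ [XYN _]] := XY.
have [wN|wN] := leqP (size w) N.
  apply: deriv_within_eq (dD w) => // t tT.
  by have /agree_tproj := XYN s t sT tT; apply.
rewrite Dp /tproj leqNgt wN /=.
apply: deriv_within_eq (deriv_within_cst T 0 s) => // t tT.
by rewrite YN // /tproj leqNgt wN.
Qed.

Lemma MinExt_diag_derivY s D : 0 <= s <= T -> diag_deriv T Y s D ->
  diag_deriv T X s D.
Proof.
move=> sT dD; have [_ [_ /(_ s sT)[D' [dD' lD']]]] := XY.
by rewrite (diag_deriv_unique sT dD (MinExt_diag_deriv sT dD' lD')).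
Qed.

Lemma good_Tv Z : (forall i, in_LieN N' (v i)) ->
  solves T v (pmodel (X 0)) (Tv v (X 0 0)) Z -> is_good T (pmodel Z).
Proof.
(* This level also covers [N' = 0], where [N * N'] would collapse to 0; the underlying truncated
   model is the truncation of the model of [Z] itself. *)
move=> vN' sZ; pose K := (N * maxn 1 N')%N.
have gZ := pmodel_solves_sgrm gX sZ.
exists K, (fun s t => tproj K (pmodel Z s t)); split; first exact: sgrm_tproj.
split=> //; split=> [s t _ _|s sT]; first by rewrite tproj_id.
have [_ [_ /(_ s sT)[D [dD lD]]]] := XY.
exists (Tv v D); split; last exact: Tv_in_LieN.
apply: (diag_deriv_eq (m := fun s t => Tv v (X s t))) => //.
  by move=> r rT; rewrite (solves_sgrm gX sZ).
by move=> w; apply: deriv_within_Tv.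
Qed.

Let pathX : is_sgrp T (X 0) := sgrm_sgrp gX.

Lemma MinExt_path_deriv t D : 0 <= t <= T -> diag_deriv T Y t D ->
  forall w, deriv_within T (fun r => Tv v (X 0 r) w) t
    (tprod (Tv v (X 0 t)) (Tv v D) w).
Proof.
move=> tT dD; apply: Tv_path_deriv => //.
apply: diag_deriv_eq (MinExt_diag_derivY tT dD) => // r rT.
by rewrite pmodel_sgrm.
Qed.

Lemma solvesN_exists M : exists W, solvesN T M v Y W.
Proof.
have z := zero_in_itv.
exists (fun t => tproj M (Tv v (X 0 t))); split; last split.
- by move=> t _; rewrite /inTN tproj_id.
- rewrite sgrm_diag // Tv_one //; apply/funext => w; rewrite /tproj.
  by case: ifP => //; case: w.
move=> t tT; have [_ [_ /(_ t tT)[D [dD lD]]]] := XY.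
have dY := MinExt_diag_deriv tT dD lD; exists D; split=> // w.
rewrite /tprodN /tproj; case wM: (size w <= M)%N; last exact: deriv_within_cst.
rewrite (agree_tprod (@agree_tprojl _ _ M (Tv v (X 0 t))) (fun _ _ => erefl) wM).
exact: MinExt_path_deriv.
Qed.

(** By triangularity the words of length at most [M] form a closed subsystem of the full equation,
    and [Y] and [X] provide the same driver [Tv v D]. *)
Lemma solvesN_unique M W : solvesN T M v Y W ->
  forall t, 0 <= t <= T -> W t = tproj M (Tv v (X 0 t)).
Proof.
move=> [WM [W0 dW]] t tT; rewrite WM //; apply/agree_tproj => w wM; apply/eqP.
rewrite -subr_eq0; apply/eqP; move: t tT w wM.
apply: (@linear_ode_eq0 M (fun r => ssub (W r) (Tv v (X 0 r)))).
  move=> w _; rewrite /ssub W0 sgrm_diag ?Tv_one ?subrr //; exact: zero_in_itv.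
move=> t tT; have [D [dD dWt]] := dW t tT; exists (Tv v D).
  rewrite Tv_nil; apply: diag_deriv_nil (MinExt_diag_derivY tT dD) => // r rT.
  exact: sgrm_nil.
move=> w wM; rewrite tprod_subl.
have := deriv_withinZ (c := -1) (MinExt_path_deriv (w := w) tT dD).
have := dWt w; rewrite /tprodN /tproj wM mulN1r => dWw /(deriv_withinD dWw).
by apply: deriv_within_eq => // r _; rewrite mulN1r.
Qed.

Lemma solvesN_Nsgrp M W : solvesN T M v Y W -> is_Nsgrp T M W.
Proof.
move=> sW; have WE := solvesN_unique sW; have z := zero_in_itv.
have [_ [gU sU]] := sgrp_Tv pathX.
split; last split; last split.
- exists 0; split=> //; rewrite WE // => /(congr1 (fun z => z [::])).
  by rewrite /tproj /= Tv_nil sgrm_nil //; apply/eqP; rewrite oner_neq0.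
- by case: sW.
- by move=> t tT; rewrite WE //; apply: shuffle_relN_tproj; apply: gU.
- move=> w; have [wM|wM] := leqP (size w) M.
    by apply: smooth_on_eq (sU w) => t tT; rewrite WE // /tproj wM.
  by apply: smooth_on_eq (smooth_on_cst0 T) => t tT; rewrite WE // /tproj leqNgt wM.
Qed.

(** Inverses and products up to degree [M] depend on their arguments up to degree [M] only, so
    truncation passes through the associated model. *)
Lemma pmodelN_Tv M W s t : solvesN T M v Y W -> 0 <= s <= T -> 0 <= t <= T ->
  pmodelN M W s t = tproj M (Tv v (X s t)).
Proof.
move=> sW sT tT; have WE := solvesN_unique sW.
rewrite /pmodelN /tprodN -pmodel_sgrm // -pmodel_Tv //; apply/agree_tproj.
apply: agree_tprod; rewrite WE //; last exact: agree_tprojl.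
apply: agree_trans (@agree_tprojl _ _ _ _) _.
by apply: agree_sinv; apply: agree_tprojl.
Qed.

End MinimalExtension.

End Paths.

(** * The truncated substitution *)

Section TruncatedSubstitution.
Variables (R : realType) (d : nat) (v : 'I_d -> tseries R d) (M : nat).
Hypothesis v0 : forall i, v i [::] = 0.
Implicit Types x y : tseries R d.

(** Substitution never lowers degree, so it preserves the ideal of series vanishing up to length [M]
    and descends to the quotient algebra. *)
Lemma TvM_tproj x : TvM M v (tproj M x) = tproj M (Tv v x).
Proof. by apply/agree_tproj/agree_Tv => //; apply: agree_tprojl. Qed.

Lemma TvM_tprodN x y :
  TvM M v (tprodN M x y) = tprodN M (TvM M v x) (TvM M v y).
Proof.
rewrite /tprodN TvM_tproj Tv_tprod //; apply/agree_tproj.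
by apply: agree_tprod; apply: agree_sym; apply: agree_tprojl.
Qed.

Lemma TvM_linear a b x y :
  TvM M v (sadd (sscale a x) (sscale b y)) =
  sadd (sscale a (TvM M v x)) (sscale b (TvM M v y)).
Proof.
rewrite /TvM Tv_add // !Tv_scale //; apply/funext => w.
by rewrite /tproj /sadd /sscale; case: ifP; rewrite ?mulr0 ?addr0.
Qed.

End TruncatedSubstitution.
Unset Implicit Arguments.

Theorem theorem2p24 (R : realType) (d : nat) (T : R) (v : 'I_d -> tseries R d) :
  (0 < d)%N -> 0 < T ->
  (* (i), paths *)
  ((forall i, is_lie_series (v i)) ->
   forall X : R -> tseries R d, is_sgrp T X ->
     (exists Z, solves T v (pmodel X) (Tv v (X 0)) Z) /\
     (forall Z, solves T v (pmodel X) (Tv v (X 0)) Z ->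
        (forall t, 0 <= t <= T -> in_G (Z t)) /\
        is_sgrp T Z /\
        (forall t, 0 <= t <= T -> Z t = Tv v (X t)) /\
        (forall s t, 0 <= s <= T -> 0 <= t <= T ->
           pmodel Z s t = Tv v (pmodel X s t)))) /\
  (* (i), models *)
  ((forall i, is_lie_series (v i)) ->
   forall X : R -> R -> tseries R d, is_sgrm T X ->
     (exists Z, solves T v (pmodel (X 0)) (Tv v (X 0 0)) Z) /\
     (forall Z, solves T v (pmodel (X 0)) (Tv v (X 0 0)) Z ->
        is_sgrm T (pmodel Z) /\
        (forall s t, 0 <= s <= T -> 0 <= t <= T ->
           pmodel Z s t = Tv v (X s t)))) /\
  (* (ii) *)
  ((forall i, is_lie_poly (v i)) ->
   forall (X Y : R -> R -> tseries R d) (N N' : nat),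
     is_Nsgrm T N Y -> is_MinExt T N Y X ->
     (forall i, in_LieN N' (v i)) ->
     (forall m, (forall i, in_LieN m (v i)) -> (N' <= m)%N) ->
     let M := (N * N')%N in
     (forall Z, solves T v (pmodel (X 0)) (Tv v (X 0 0)) Z -> is_good T (pmodel Z)) /\
     ((forall x y, inTN M x -> inTN M y ->
         TvM M v (tprodN M x y) = tprodN M (TvM M v x) (TvM M v y)) /\
      (forall a b x y, inTN M x -> inTN M y ->
         TvM M v (sadd (sscale a x) (sscale b y)) =
         sadd (sscale a (TvM M v x)) (sscale b (TvM M v y))) /\
      TvM M v (tproj M (@sone R d)) = tproj M (@sone R d)) /\
     (exists W, solvesN T M v Y W) /\
     (forall W, solvesN T M v Y W ->
        is_Nsgrp T M W /\
        (forall s t, 0 <= s <= T -> 0 <= t <= T ->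
           pmodelN M W s t = TvM M v (tproj M (X s t)) /\
           TvM M v (tproj M (X s t)) = tproj M (Tv v (X s t))))).
Proof.
move=> _ T0; split; last split.
- move=> lv X gX; have pv i := primitive_lie_series (lv i).
  split; first by exists (fun t => Tv v (X t)); apply: solves_Tv.
  move=> Z sZ; have ZE := solves_unique T0 pv gX sZ.
  (* A solution is constrained on the interval only, so the property is transferred along equality
     there, not along equality of functions. *)
  have gZ := sgrp_eq (fun t tT => esym (ZE t tT)) (sgrp_Tv T0 pv gX).
  split; first by move=> t tT; split; [exact: sgrp_nil gZ tT|apply: gZ.2.1].
  do 2!split=> //; move=> s t sT tT.
  by rewrite -(pmodel_Tv pv t gX sT) /pmodel !ZE.
- move=> lv X gX; have pv i := primitive_lie_series (lv i).
  split.
    by exists (fun t => Tv v (X 0 t)); apply: solves_Tv => //; apply: sgrm_sgrp.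
  move=> Z sZ; split; first exact: pmodel_solves_sgrm sZ.
  exact: solves_sgrm sZ.
- move=> lv X Y N N' gY XY vN' _ M; have pv i := primitive_lie_poly (lv i).
  have v0 i := primitive0 (pv i).
  split; first by move=> Z sZ; apply: (good_Tv T0 pv lv XY vN' sZ).
  split.
    split; first by move=> x y _ _; exact: TvM_tprodN.
    split; first by move=> a b x y _ _; exact: TvM_linear.
    by rewrite TvM_tproj // Tv_one.
  split; first exact: solvesN_exists gY XY M.
  move=> W sW; split; first exact: (solvesN_Nsgrp T0 pv gY XY sW).
  move=> s t sT tT; rewrite TvM_tproj //; split=> //.
  exact: (pmodelN_Tv T0 pv gY XY sW sT tT).
Qed.
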